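(* The following algorithm is a $4$-approximation for the unrestricted MV-mTSP$_+$ with disjoint tours, and it runs in time polynomial in $n$, $m$ and $\log r(V)$. (That is, on every instance $(G,c,r,m)$ it returns NO if no feasible solution exists, and otherwise returns a feasible solution $X$ with $\operatorname{cost}(X)\leq 4\cdot\mathsf{OPT}$, where $\mathsf{OPT}$ is the minimum cost of a feasible solution.) Algorithm. (1) If $m>|V|$, return NO. (2) Determine a minimum cost spanning forest $F$ of $G$ consisting of $m$ components, and let $F_1,\dots,F_m$ be its components. (3) For $i=1,\dots,m$: if $|V(F_i)|\geq 2$, let $H_i$ be the cycle on $V(F_i)$ obtained by duplicating the edges of $F_i$ and applying shortcuts; otherwise let $H_i$ consist of a single copy of the self-loop on the vertex in $V(F_i)$. (4) For each $v\in V$, pick an index $i$ with $v\in V(H_i)$ and add $r(v)-1$ copies of the self-loop $vv$ to $H_i$. Denote the resulting multigraphs by $X_i$, $i=1,\dots,m$, and return $X=X_1\cup\dots\cup X_m$.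
   Context: Instance: a finite vertex set $V$ with $n=|V|$; $G=(V,E)$ is the complete undirected graph on $V$, including a self-loop $vv$ at each $v$; symmetric costs $c(uv)\geq 0$ (self-loop costs $c(vv)$ are not assumed to be zero) that are metric: $c(uw)\leq c(uv)+c(vw)$ for all $u,v,w\in V$, and $c(vv)\leq 2\min_{u\in V\setminus\{v\}}c(uv)$ for all $v\in V$; requests $r:V\to\mathbb{Z}_{\geq 1}$ (encoded in binary), with $r(V)=\sum_{v\in V} r(v)$; an integer $m\geq 1$ (number of agents). A multigraph is a multiset $X$ of edges (self-loops allowed) on $V$; $\operatorname{cost}(X)=\sum_{uv} x(uv)c(uv)$, where $x(uv)$ is the multiplicity of $uv$ in $X$. The degree $\dot\delta_X(v)$ counts each copy of the self-loop $vv$ twice. An MVTSP tour is a connected multigraph in which every degree is even (the edge multiset of a closed walk); a multigraph with even degrees visits $v$ exactly $\dot\delta_X(v)/2$ times. An isolated vertex without a self-loop counts as no visit. A tour is non-empty if it has at least one edge. Unrestricted MV-mTSP$_+$ with disjoint tours: find a minimum-cost multigraph $X$ visiting each $v\in V$ exactly $r(v)$ times that has exactly $m$ connected components $X_1,\dots,X_m$, each of them a non-empty MVTSP tour. Multigraphs are represented compactly, by storing each edge together with its multiplicity in binary. Duplicating the edges of a tree and applying shortcuts means: take a closed Eulerian walk of the tree with all edges doubled and skip repeated vertices, obtaining a cycle through all its vertices (on two vertices, the cycle consists of two parallel edges). *)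

(* Defs.v *)
From HB Require Import structures.
From mathcomp Require Import all_boot all_order all_algebra.

Set Implicit Arguments.
Unset Strict Implicit.
Unset Printing Implicit Defensive.

Import Order.TTheory GRing.Theory Num.Theory.

(** * Multigraphs *)

(* Edges of the complete graph with self-loops: unordered pairs, the self-loop
   at v being the singleton [set v] = [set v; v]. *)
Definition edge (V : finType) := {e : {set V} | 0 < #|e| <= 2}.

Lemma uv_subproof (V : finType) (u v : V) : 0 < #|[set u; v]| <= 2.
Proof. by rewrite cards2; case: (u != v). Qed.

Definition uv (V : finType) (u v : V) : edge V :=
  exist (fun e : {set V} => 0 < #|e| <= 2) [set u; v] (uv_subproof u v).

Definition loop (V : finType) (v : V) : edge V := uv v v.

(* X e is the multiplicity of e. *)
Definition mgraph (V : finType) := {ffun edge V -> nat}.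

Section Multigraphs.
Variable V : finType.
Implicit Types (X : mgraph V) (F : {set edge V}) (S : {set V}).

(* The first sum already contains each self-loop once. *)
Definition deg X (v : V) : nat :=
  \sum_(e : edge V | v \in val e) X e + X (loop v).

Definition visits X (v : V) : nat := (deg X v)./2.

Definition even_degrees X : Prop := forall v, ~~ odd (deg X v).

Definition verts X : {set V} := [set v | 0 < deg X v].

Definition supp X : {set edge V} := [set e | 0 < X e].

Definition adj F : rel V := fun u v => uv u v \in F.

(* The vertex sets of the connected components of the graph (V, F); isolated
   vertices are components. *)
Definition comps F : {set {set V}} :=
  [set [set w | connect (adj F) u w] | u : V].

(* Connectedness is required on the vertices touched by X only: an MVTSP tour
   need not touch all of V. *)
Definition is_tour X : Prop :=
  even_degrees X /\ {in verts X &, forall u v, connect (adj (supp X)) u v}.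

Definition nonempty X : Prop := exists e, 0 < X e.

Definition restrict X S : mgraph V :=
  [ffun e : edge V => if val e \subset S then X e else 0].

(* The second condition excludes cycles of length at least 3, the first one
   self-loops; an edge set has no parallel edges. *)
Definition is_forest F : Prop :=
  (forall e, e \in F -> #|val e| = 2) /\
  (forall p : seq V, 2 < size p -> ~ ucycle (adj F) p).

(* A closed walk w_0, ..., w_(k-1), w_0 is given by the sequence
   [:: w_0; ...; w_(k-1)]. *)
Definition walk_edges (w : seq V) : seq (edge V) :=
  [seq uv p.1 p.2 | p <- zip w (rot 1 w)].

Definition walk_mgraph (w : seq V) : mgraph V :=
  [ffun e : edge V => count_mem e (walk_edges w)].

(* undup keeps last occurrences, so this keeps the first ones. *)
Definition skip_repeated (w : seq V) : seq V := rev (undup (rev w)).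

Definition double_and_shortcut F (H : mgraph V) : Prop :=
  exists w : seq V,
    (forall e, walk_mgraph w e = (e \in F).*2) /\
    H = walk_mgraph (skip_repeated w).

End Multigraphs.

(** * Instances and feasible solutions *)

Record instance (R : realFieldType) (V : finType) := Instance {
  cost : edge V -> R;
  req : V -> nat;
  agents : nat;
  cost_ge0 : forall e, (0 <= cost e)%R;
  cost_triangle : forall u v w,
    (cost (uv u w) <= cost (uv u v) + cost (uv v w))%R;
  cost_loop : forall v u, u != v -> (cost (loop v) <= 2%:R * cost (uv u v))%R;
  req_gt0 : forall v, 0 < req v;
  agents_gt0 : 0 < agents
}.

Section Problem.
Variables (R : realFieldType) (V : finType) (I : instance R V).
Implicit Types (X : mgraph V) (F : {set edge V}).

Definition total_req : nat := \sum_(v : V) req I v.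

Definition mcost X : R := (\sum_(e : edge V) cost I e *+ X e)%R.

Definition feasible X : Prop :=
  [/\ even_degrees X,
      forall v, visits X v = req I v,
      #|comps (supp X)| = agents I
    & forall S, S \in comps (supp X) ->
        is_tour (restrict X S) /\ nonempty (restrict X S)].

Definition is_opt (opt : R) : Prop :=
  (exists2 X, feasible X & mcost X = opt) /\
  (forall X, feasible X -> (opt <= mcost X)%R).

(** * The algorithm *)

Definition spanning_forest F : Prop :=
  is_forest F /\ #|comps F| = agents I.

Definition min_spanning_forest F : Prop :=
  spanning_forest F /\
  forall F', spanning_forest F' ->
    (\sum_(e in F) cost I e <= \sum_(e in F') cost I e)%R.

Definition forest_comp F (S : {set V}) : {set edge V} :=
  [set e in F | val e \subset S].

(* S is the vertex set of the component. *)
Definition component_tour F (S : {set V}) (H : mgraph V) : Prop :=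
  if 2 <= #|S| then double_and_shortcut (forest_comp F S) H
  else exists2 v, S = [set v] & H = [ffun e : edge V => (e == loop v) : nat].

Definition add_loops (m : nat) (H : 'I_m -> mgraph V) (pick : V -> 'I_m)
    (i : 'I_m) : mgraph V :=
  [ffun e : edge V => H i e + \sum_(v | (pick v == i) && (e == loop v)) (req I v - 1)].

(* alg_run res: some run of the algorithm returns res, where None stands for
   NO. The choices left open by the description (minimum forest, numbering of
   its components, Eulerian walks, indices i) are nondeterministic. *)
Inductive alg_run : option (mgraph V) -> Prop :=
| run_no : #|V| < agents I -> alg_run None
| run_yes (F : {set edge V}) (S : 'I_(agents I) -> {set V})
    (H : 'I_(agents I) -> mgraph V) (pick : V -> 'I_(agents I)) :
    agents I <= #|V| ->
    min_spanning_forest F ->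
    injective S -> [set S i | i : 'I_(agents I)] = comps F ->
    (forall i, component_tour F (S i) (H i)) ->
    (forall v, v \in verts (H (pick v))) ->
    alg_run (Some [ffun e : edge V => \sum_(i < agents I) add_loops H pick i e]).

End Problem.

(** * Model of computation

  A logarithmic-cost random access machine, programmed in a structured
  language. The memory consists of arrays of natural numbers (finitely many of
  which occur in a program), initially zero. Every operation is charged the
  number of binary digits of all numbers involved, addresses included. Vertices
  are the numbers 0, ..., n-1. The costs may belong to any ordered field; they
  are not stored in memory, and a program can only compare two of them, which
  takes one step. *)

Inductive expr : Type :=
| Const of nat
| Read of nat & expr            (* Read a i: cell i of array a *)
| Add of expr & expr
| Sub of expr & expr            (* truncated *)
| Leq of expr & expr
| InN                           (* input: number of vertices *)
| InM                           (* input: number of agents *)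
| InReq of expr                 (* input: number of requests at a vertex *)
| CostLeq of expr & expr & expr & expr. (* input: c(ij) <= c(kl) *)

Inductive cmd : Type :=
| Skip
| Write of nat & expr & expr    (* Write a i x: cell i of array a := x *)
| Seq of cmd & cmd
| If of expr & cmd & cmd
| While of expr & cmd
| Emit of expr & expr & expr    (* output edge ij with a multiplicity *)
| AnswerNo.

Record state := State {
  mem : nat -> nat -> nat;
  out : option (seq (nat * nat * nat))  (* None once NO has been answered *)
}.

Definition init_state : state := State (fun _ _ => 0) (Some [::]).

Definition store (s : state) (a i x : nat) : state :=
  State (fun b j => if (b == a) && (j == i) then x else mem s b j) (out s).

Definition emit (s : state) (t : nat * nat * nat) : state :=
  State (mem s) (omap (rcons^~ t) (out s)).

Definition answer_no (s : state) : state := State (mem s) None.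

(* Number of binary digits, with bits 0 = 1. *)
Definition bits (k : nat) : nat := (trunc_log 2 k).+1.

Definition vertex_at (V : finType) (i : nat) : option V := onth (enum V) i.

Definition edge_at (V : finType) (i j : nat) : option (edge V) :=
  if (vertex_at V i, vertex_at V j) is (Some u, Some v) then Some (uv u v)
  else None.

Section Semantics.
Variables (R : realFieldType) (V : finType) (I : instance R V).

Fixpoint eval (s : state) (x : expr) : nat :=
  match x with
  | Const k => k
  | Read a i => mem s a (eval s i)
  | Add x y => eval s x + eval s y
  | Sub x y => eval s x - eval s y
  | Leq x y => eval s x <= eval s y
  | InN => #|V|
  | InM => agents I
  | InReq i => if vertex_at V (eval s i) is Some v then req I v else 0
  | CostLeq i j k l =>
      if (edge_at V (eval s i) (eval s j), edge_at V (eval s k) (eval s l))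
        is (Some e, Some f) then (cost I e <= cost I f)%R else false
  end.

Fixpoint etime (s : state) (x : expr) : nat :=
  bits (eval s x) +
  match x with
  | Const _ | InN | InM => 0
  | Read _ i | InReq i => etime s i
  | Add x y | Sub x y | Leq x y => etime s x + etime s y
  | CostLeq i j k l => etime s i + etime s j + etime s k + etime s l
  end.

(* exec p s s' t: started in state s, program p halts in state s' after time
   t. *)
Inductive exec : cmd -> state -> state -> nat -> Prop :=
| exec_Skip s : exec Skip s s 1
| exec_Write s a i x :
    exec (Write a i x) s (store s a (eval s i) (eval s x))
      (etime s i + etime s x)
| exec_Seq p q s s1 s2 t1 t2 :
    exec p s s1 t1 -> exec q s1 s2 t2 -> exec (Seq p q) s s2 (t1 + t2)
| exec_IfTrue x p q s s1 t :
    eval s x != 0 -> exec p s s1 t -> exec (If x p q) s s1 (etime s x + t)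
| exec_IfFalse x p q s s1 t :
    eval s x = 0 -> exec q s s1 t -> exec (If x p q) s s1 (etime s x + t)
| exec_WhileFalse x p s :
    eval s x = 0 -> exec (While x p) s s (etime s x)
| exec_WhileTrue x p s s1 s2 t1 t2 :
    eval s x != 0 -> exec p s s1 t1 -> exec (While x p) s1 s2 t2 ->
    exec (While x p) s s2 (etime s x + t1 + t2)
| exec_Emit s i j k :
    exec (Emit i j k) s (emit s (eval s i, eval s j, eval s k))
      (etime s i + etime s j + etime s k)
| exec_AnswerNo s : exec AnswerNo s (answer_no s) 1.

End Semantics.

(* Compact representation: every edge of X is listed exactly once, together with
   its multiplicity (edges of multiplicity 0 may be listed too). *)
Definition represents (V : finType) (l : seq (nat * nat * nat))
    (X : mgraph V) : Prop :=
  [/\ uniq [seq edge_at V t.1.1 t.1.2 | t <- l],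
      forall t, t \in l ->
        exists2 e, edge_at V t.1.1 t.1.2 = Some e & t.2 = X e
    & forall e, 0 < X e -> exists2 t, t \in l & edge_at V t.1.1 t.1.2 = Some e].

Definition outputs (V : finType) (s : state) (res : option (mgraph V)) : Prop :=
  match out s, res with
  | None, None => True
  | Some l, Some X => represents l X
  | _, _ => False
  end.

(* Main.v *)
(** A feasible solution X has m components, so it contains a spanning forest
  with m components, whence c(F) <= OPT. Counting the costs of X at the vertices,
  sum_v r(v) c(vv) = 1/2 sum_v deg(v) c(vv) <= 2 OPT because c(uu) and c(vv) are
  at most 2 c(uv). The cycles cost at most 2 c(F) by the triangle inequality
  and the self-loops at most sum_v r(v) c(vv), in total 4 OPT.

  The program computes a minimum spanning tree by Prim's algorithm and keeps the
  n - m cheapest of its edges. The edges of cost at most th of Prim's tree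
  connect whatever edges of cost at most th connect at all, so for every th the
  kept forest has at least as many edges of cost at most th as any forest with
  n - m edges; hence it is minimal. Going through the vertices in Prim's order, a
  kept vertex is inserted behind its parent in a cyclic list: this is the
  shortcut of the walk that makes a detour to the new leaf at the first visit of
  the parent. *)
Require Import Defs.
From mathcomp Require Import all_boot all_order all_algebra.
From mathcomp Require Import zify ring lra.

Set Implicit Arguments.
Unset Strict Implicit.
Unset Printing Implicit Defensive.

Import Order.TTheory GRing.Theory Num.Theory.

(** * Forests and components *)

(** The two claims meet in [alg_run]: the guarantee is proved for every run, whatever forest, walks
    and indices are chosen, and the program only has to produce some run. A budget of r(v) c(vv)
    covers all self-loops because the r(v) - 1 added loops leave one c(vv) at each vertex, which
    pays for the loop of a one-vertex component. The program can compare costs but not add them, so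
    the minimality of its forest is derived from counting the edges below each threshold. Euler
    walks are never stored; they accompany the successor pointers in the invariant only. Time needs
    no invariant: every loop has at most n rounds and every stored number is at most n + m + r(V),
    so a bound can be read off the syntax of the program. *)

Section Graphs.
Variable V : finType.
Implicit Types (u v w x y : V) (e : edge V) (A B F : {set edge V}).

Lemma uvC u v : uv u v = uv v u.
Proof. by apply: val_inj; rewrite /= setUC. Qed.

Lemma edgeP e : exists u v, e = uv u v.
Proof.
case: e => s s12; have /andP[/card_gt0P[u us] s2] := s12.
case: (boolP (s == [set u])) => [/eqP eq_s | s_u].
  by exists u, u; apply: val_inj; rewrite /= eq_s setUid.
have : [set u] \proper s by rewrite properEneq eq_sym s_u sub1set.
case/properP=> _ [v vs /set1P v_u]; exists u, v; apply: val_inj => /=.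
apply/esym/eqP; rewrite eqEcard subUset !sub1set us vs cards2.
by have -> : u != v by apply/eqP => uv; apply: v_u.
Qed.

Lemma uv_eq u v x y :
  (uv u v == uv x y) = ((u == x) && (v == y)) || ((u == y) && (v == x)).
Proof.
apply/eqP/idP => [[/setP E] | /orP[] /andP[/eqP-> /eqP->] //]; last exact: uvC.
have := E u; have := E v; have := E x; have := E y.
rewrite !inE !eqxx !orbT /= [y == u]eq_sym [y == v]eq_sym [x == u]eq_sym.
rewrite [x == v]eq_sym.
by do 4!case: eqP => ? //=; subst.
Qed.

Lemma in_uv u x y : (u \in val (uv x y)) = (u == x) || (u == y).
Proof. by rewrite !inE. Qed.

Lemma loopP u v x : (uv u v == loop x) = (u == x) && (v == x).
Proof. by rewrite uv_eq; do 2!case: eqP. Qed.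

Lemma uv_card u v : #|val (uv u v)| = (u != v).+1.
Proof. by rewrite cards2. Qed.

Lemma adj_sym A : symmetric (adj A).
Proof. by move=> u v; rewrite /adj uvC. Qed.

Lemma connect_adj_sym A : connect_sym (adj A).
Proof. exact/sym_connect_sym/adj_sym. Qed.

Definition class A u : {set V} := [set w | connect (adj A) u w].

Lemma class_eq A u v : (class A u == class A v) = connect (adj A) u v.
Proof.
apply/eqP/idP => [/setP/(_ v) | uv]; first by rewrite !inE connect0.
by apply/setP=> w; rewrite !inE (same_connect (connect_adj_sym A) uv).
Qed.

(** Maps a component of a finer graph to the component of [B] around it; component counts are
    compared through images under this map. *)
Definition coarsen B (S : {set V}) : {set V} :=
  [set w | [exists u in S, connect (adj B) u w]].

Lemma coarsen_class A B u :
    (forall u v, connect (adj A) u v -> connect (adj B) u v) ->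
  coarsen B (class A u) = class B u.
Proof.
move=> AB; apply/setP=> w; rewrite !inE; apply/existsP/idP => [[v]|uw].
  by rewrite inE => /andP[/AB/connect_trans h /h].
by exists u; rewrite inE connect0.
Qed.

(** Coarsening maps the classes of the representatives in [P] onto all components of [B]. A proper
    subset [P] allows for the loss of a class when an edge is added. *)
Lemma card_comps_sub A B (P : {set V}) :
    (forall u v, connect (adj A) u v -> connect (adj B) u v) ->
    (forall u, exists2 v, v \in P & connect (adj B) u v) ->
  #|comps B| <= #|[set class A u | u in P]|.
Proof.
move=> AB PB.
apply: leq_trans (leq_imset_card (coarsen B) [set class A u | u in P]).
apply/subset_leq_card/subsetP => S /imsetP[u _ ->].
have [v vP uv] := PB u; apply/imsetP; exists (class A v).
  by apply/imsetP; exists v.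
by rewrite coarsen_class //; apply/eqP; rewrite class_eq.
Qed.

Lemma card_comps_mono A B :
    (forall u v, connect (adj A) u v -> connect (adj B) u v) ->
  #|comps B| <= #|comps A|.
Proof.
move=> AB; have := @card_comps_sub A B setT AB.
have -> : [set class A u | u in [set: V]] = comps A.
  by apply/setP=> S; apply/imsetP/imsetP => -[u _ ->]; exists u; rewrite ?inE.
by apply=> u; exists u => //; apply: connect0.
Qed.

Lemma comps_eq A B : connect (adj A) =2 connect (adj B) -> comps A = comps B.
Proof.
by move=> E; apply: eq_imset => u; apply/setP => w; rewrite !inE E.
Qed.

(** A walk that crosses the new edge several times can be shortened to cross it at most once, in one
    of two directions; hence the three cases. *)
Lemma connect_adjU1 A x y u v :
  connect (adj (uv x y |: A)) u v =
  [|| connect (adj A) u v,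
      connect (adj A) u x && connect (adj A) y v
    | connect (adj A) u y && connect (adj A) x v].
Proof.
have symA := connect_adj_sym A.
have subA a b : connect (adj A) a b -> connect (adj (uv x y |: A)) a b.
  by apply: connect_sub => c d cd; apply: connect1; rewrite /adj inE; apply/orP; right.
have xy : connect (adj (uv x y |: A)) x y by apply: connect1; rewrite /adj !inE eqxx.
apply/idP/idP => [/connectP[p]|].
  elim: p u => [|z p IH] u /=; first by move=> _ ->; rewrite connect0.
  case/andP=> uz zp vE; have {IH zp vE} := IH z zp vE.
  move: uz; rewrite /adj !inE uv_eq => /orP[|uz].
    case/orP=> /andP[/eqP-> /eqP->]; rewrite !connect0 /=.
      by case/or3P=> [->|/andP[_ ->]|->]; rewrite ?orbT.
    by case/or3P=> [->|->|/andP[_ ->]]; rewrite ?orbT.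
  have uz' : connect (adj A) u z by apply: connect1.
  by rewrite !(same_connect symA uz').
case/or3P => [/subA //|/andP[/subA ux /subA yv]|/andP[/subA uy /subA xv]].
  exact: connect_trans ux (connect_trans xy yv).
apply: connect_trans uy (connect_trans _ xv).
by rewrite connect_adj_sym.
Qed.

Lemma card_compsU1_connect A x y :
  connect (adj A) x y -> connect (adj (uv x y |: A)) =2 connect (adj A).
Proof.
move=> xy u v; rewrite connect_adjU1; apply/or3P/idP => [|uv]; last by constructor 1.
have yx : connect (adj A) y x by rewrite connect_adj_sym.
case=> // /andP[h1 h2]; apply: connect_trans h1 _;
  by [apply: connect_trans xy h2 | apply: connect_trans yx h2].
Qed.

(** Drop the class of [x], which merges with that of [y]: coarsening maps the remaining classes
    bijectively onto the components of the larger graph. *)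
Lemma card_compsU1 A x y :
  ~~ connect (adj A) x y -> #|comps A| = #|comps (uv x y |: A)|.+1.
Proof.
move=> xy; set B := uv x y |: A.
pose P := [set u | ~~ connect (adj A) u x].
have comps0 : comps A = class A x |: [set class A u | u in P].
  apply/setP=> S; rewrite in_setU1; apply/imsetP/orP => [[u _ ->]|].
    case: (boolP (connect (adj A) u x)) => ux.
      by left; rewrite class_eq.
    by right; apply/imsetP; exists u; rewrite ?inE.
  by case=> [/eqP->|/imsetP[u _ ->]]; [exists x|exists u].
have -> : #|comps A| = #|[set class A u | u in P]|.+1.
  rewrite comps0 cardsU1; suff -> : class A x \notin [set class A u | u in P] by [].
  apply/imsetP=> -[u]; rewrite inE => /negP ux /eqP; rewrite class_eq.
  by rewrite connect_adj_sym.
congr _.+1; apply/eqP; rewrite eqn_leq; apply/andP; split; last first.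
  apply: card_comps_sub => [u v uv|u]; first by rewrite connect_adjU1 uv.
  case: (boolP (connect (adj A) u x)) => ux; last by exists u; rewrite ?inE.
  exists y; first by rewrite inE connect_adj_sym.
  by rewrite connect_adjU1 ux connect0 !orbT.
have inj : {in P &, forall u v, class B u = class B v -> class A u = class A v}.
  move=> u v; rewrite !inE => ux vx /eqP; rewrite class_eq connect_adjU1.
  rewrite (negPf ux) /= [connect _ x v]connect_adj_sym (negPf vx) andbF orbF.
  by rewrite -class_eq => /eqP.
have subB a b : connect (adj A) a b -> connect (adj B) a b.
  by move=> ab; rewrite connect_adjU1 ab.
rewrite -(card_in_imset (f := coarsen B)).
  apply/subset_leq_card/subsetP=> T /imsetP[S /imsetP[u uP ->] ->].
  by rewrite coarsen_class //; apply/imsetP; exists u.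
move=> S T /imsetP[u uP ->] /imsetP[v vP ->].
by rewrite !coarsen_class //; apply: inj.
Qed.

Lemma connect_set0 u v : connect (adj set0) u v = (u == v).
Proof.
apply/connectP/eqP => [[[|w p] /=]|->]; [by move=> _ -> | by rewrite /adj inE |].
by exists [::].
Qed.

Lemma card_comps0 : #|comps (set0 : {set edge V})| = #|V|.
Proof.
rewrite card_in_imset // => u v _ _ E.
by apply/eqP; rewrite -connect_set0 -class_eq; apply/eqP.
Qed.

Lemma card_comps_leq A : #|comps A| <= #|V|.
Proof. exact: leq_imset_card. Qed.

Lemma setU1_ind (P : {set edge V} -> Prop) :
  P set0 -> (forall e A, e \notin A -> P A -> P (e |: A)) -> forall A, P A.
Proof.
move=> P0 P1 A; have [n leAn] := ubnP #|A|.
elim: n A leAn => // n IH A leAn.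
have [->//|[e eA]] := set_0Vmem A.
rewrite -(setD1K eA); apply: P1; first by rewrite !inE eqxx.
by apply: IH; move: leAn; rewrite (cardsD1 e A) eA.
Qed.

(** Starting from isolated vertices, each added edge lowers the number of components by at most
    one. *)
Lemma card_comps_geq A : #|V| <= #|A| + #|comps A|.
Proof.
elim/setU1_ind: A => [|e A eA IH]; first by rewrite card_comps0 leq_addl.
rewrite cardsU1 eA; have [x [y exy]] := edgeP e.
case: (boolP (connect (adj A) x y)) => xy.
  rewrite exy (comps_eq (card_compsU1_connect xy)).
  by apply: leq_trans IH _; rewrite leq_add2r leq_addl.
by move: IH; rewrite (card_compsU1 xy) -exy; lia.
Qed.

(** The rest of the cycle leads from [y] back to [x] without this edge. With [p] empty it would run
    back and forth along a single edge. *)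
Lemma ucycle_connect F x y p :
  ucycle (adj F) [:: x, y & p] -> 0 < size p ->
  uv x y \in F /\ connect (adj (F :\ uv x y)) x y.
Proof.
case: p => [|z p] // /andP[/= /and3P[xy yz zp]].
rewrite !inE !negb_or => /andP[/and3P[x_y x_z xp] /andP[/andP[y_z yp] _]] _.
split=> //; rewrite connect_adj_sym; apply/connectP; exists (z :: rcons p x); last first.
  by rewrite /= last_rcons.
have xNy : x != y by [].
rewrite /= {1}/adj in_setD1 [uv y z \in F]yz uv_eq andbT; apply/andP; split.
  by rewrite negb_or !negb_and [y == x]eq_sym xNy [z == x]eq_sym x_z !orbT.
have : all (predC1 y) (z :: rcons p x).
  rewrite /= [z == y]eq_sym y_z all_rcons /= x_y /=.
  by apply/allP=> w wp /=; apply: contraNneq yp => <-.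
move/(sub_in_path (e := adj F)) => sub; apply: sub zp => a b.
move=> a_y b_y; rewrite /adj in_setD1 => ->; rewrite andbT uv_eq negb_or !negb_and.
by move: a_y b_y; rewrite /= !inE => -> ->; rewrite orbT.
Qed.

(** A simple path avoiding the edge would close with it to a cycle. Length 0 would mean x = y, and
    length 1 would use the removed edge itself. *)
Lemma connect_ucycle F x y : is_forest F -> uv x y \in F ->
  ~~ connect (adj (F :\ uv x y)) x y.
Proof.
move=> [F2 Fac] xyF; have x_y : x != y.
  by have := F2 _ xyF; rewrite uv_card; case: (x != y).
apply/connectP=> -[q /shortenP[p]]; case: p => [|z [|t p]] /=.
- by move=> _ _ _ yx; rewrite yx eqxx in x_y.
- rewrite andbT /adj inE => /andP[/negP xz _] _ _ zE; apply: xz.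
  by rewrite in_set1 zE.
move=> pathp uniqp _ yE; apply: (Fac [:: x, z, t & p]) => //.
rewrite /ucycle /=; apply/andP; split; last by [].
have subF a b : adj (F :\ uv x y) a b -> adj F a b by rewrite /adj inE => /andP[].
move: pathp => /and3P[/subF-> /subF-> /=] /(sub_path subF) pathp.
by rewrite rcons_path pathp -yE /adj uvC.
Qed.

Lemma forest_card F : is_forest F -> #|F| + #|comps F| = #|V|.
Proof.
elim/setU1_ind: F => [_|e F eF IH forF]; first by rewrite cards0 card_comps0.
have {}IH : #|F| + #|comps F| = #|V|.
  apply: IH; case: forF => F2 Fac; split=> [f fF|p p2 cyc].
    by apply: F2; rewrite inE fF orbT.
  apply: (Fac p p2); move: cyc; rewrite /ucycle => /andP[cyc ->]; rewrite andbT.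
  by apply: sub_cycle cyc => a b; rewrite /adj inE => ->; rewrite orbT.
have [x [y exy]] := edgeP e; subst e.
have := connect_ucycle forF (setU11 _ _).
rewrite setU1K // => /card_compsU1 E.
by rewrite cardsU1 eF -IH E; lia.
Qed.

(** A cycle has an edge whose removal keeps the components, which leaves fewer edges than
    [card_comps_geq] requires. Acyclicity thus becomes a matter of counting. *)
Lemma card_forest F : (forall e, e \in F -> #|val e| = 2) ->
  #|F| + #|comps F| = #|V| -> is_forest F.
Proof.
move=> F2 cardF; split=> // -[|x [|y p]] // p2 /ucycle_connect/(_ p2) [xyF xy].
have := card_comps_geq (F :\ uv x y).
rewrite -(comps_eq (card_compsU1_connect xy)) setD1K //.
by rewrite -cardF (cardsD1 (uv x y) F) xyF -addnA add1n ltnn.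
Qed.

Lemma forest_sub A F : is_forest F -> A \subset F -> is_forest A.
Proof.
move=> [F2 Fac] /subsetP AF; split=> [e /AF/F2 //|p p2 cyc].
apply: (Fac p p2); move: cyc; rewrite /ucycle => /andP[cyc ->]; rewrite andbT.
by apply: sub_cycle cyc => a b /AF.
Qed.

(** Kruskal's construction: an edge is taken exactly when it joins two components of the forest so
    far. *)
Lemma spanning_subforest A : exists F : {set edge V},
  [/\ F \subset A, is_forest F & connect (adj F) =2 connect (adj A)].
Proof.
elim/setU1_ind: A => [|e A _ [F [FA forF EF]]].
  exists set0; split=> //; apply: card_forest => [e|]; first by rewrite inE.
  by rewrite cards0 card_comps0.
have [x [y exy]] := edgeP e; subst e.
have E : connect (adj (uv x y |: F)) =2 connect (adj (uv x y |: A)).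
  by move=> u v; rewrite !connect_adjU1 !EF.
case: (boolP (connect (adj F) x y)) => xy.
  exists F; split=> //; first by rewrite (subset_trans FA) ?subsetUr.
  by move=> u v; rewrite -E (card_compsU1_connect xy).
exists (uv x y |: F); split=> //; first by rewrite setUS.
have xyF : uv x y \notin F by apply: contra xy => xyF; apply: connect1.
apply: card_forest => [e|].
  case/setU1P=> [->|/forF.1 //]; rewrite uv_card.
  by case: eqP xy => // ->; rewrite connect0.
rewrite cardsU1 xyF -(forest_card forF) (card_compsU1 xy); lia.
Qed.

Lemma connect_exit (r : rel V) (A : {set V}) x y :
  connect r x y -> x \in A -> y \notin A ->
  exists a b, [/\ a \in A, b \notin A & r a b].
Proof.
case/connectP=> p; elim: p x => [|z p IH] x /=; first by move=> _ -> ->.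
case/andP=> xz zp yE xA yA; case: (boolP (z \in A)) => zA; first exact: IH zp yE zA yA.
by exists x, z.
Qed.

End Graphs.

(** * The approximation guarantee *)

Section Walks.
Variable V : finType.
Implicit Types (u v x y : V) (e : edge V) (p w s q : seq V) (X : mgraph V).

Lemma walk_edges_cons x p : walk_edges (x :: p) = pairmap (@uv V) x (rcons p x).
Proof.
rewrite /walk_edges rot1_cons.
suff: forall y, [seq uv z.1 z.2 | z <- zip (y :: p) (rcons p x)] =
  pairmap (@uv V) y (rcons p x) by apply.
by elim: p => [|z p IH] y //=; rewrite IH.
Qed.

Lemma path_adj (E : {set edge V}) x s :
  path (adj E) x s = all (mem E) (pairmap (@uv V) x s).
Proof. by elim: s x => [|y s IH] x //=; rewrite IH. Qed.

Lemma cycle_adj (E : {set edge V}) w :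
  cycle (adj E) w = all (mem E) (walk_edges w).
Proof. by case: w => // x p; rewrite walk_edges_cons -path_adj. Qed.

Lemma walk_edges_mem w e : e \in walk_edges w ->
  exists u v, [/\ u \in w, v \in w & e = uv u v].
Proof.
case/mapP=> -[u v] /= uvw ->; exists u, v; split=> //.
  by move: (map_f fst uvw); rewrite -/(unzip1 _) unzip1_zip ?size_rot.
by move: (map_f snd uvw); rewrite -/(unzip2 _) unzip2_zip ?size_rot // mem_rot.
Qed.

Lemma size_walk_edges w : size (walk_edges w) = size w.
Proof. by rewrite size_map size1_zip ?size_rot. Qed.

Lemma sum_count_mem (T : finType) (s : seq T) (f : T -> nat) :
  \sum_x count_mem x s * f x = \sum_(x <- s) f x.
Proof.
elim: s => [|y s IH]; first by rewrite big_nil big1.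
rewrite big_cons -IH (bigD1 y) //= [in RHS](bigD1 y) //= eqxx mulnDl mul1n addnA.
by congr (_ + _); apply: eq_bigr => x /negPf; rewrite eq_sym => ->.
Qed.

(** Makes the degree linear in [X], with coefficient 2 for the loop at [v]; the double counting
    below exchanges such sums. *)
Lemma degE X v : deg X v = \sum_e X e * ((v \in val e) + (e == loop v)).
Proof.
rewrite /deg; under [RHS]eq_bigr do rewrite mulnDr.
rewrite big_split /=; congr (_ + _).
  by rewrite big_mkcond; apply: eq_bigr => e _; case: (v \in _); rewrite ?muln0 ?muln1.
by rewrite (bigD1 (loop v)) //= eqxx muln1 big1 ?addn0 // => e /negPf->; rewrite muln0.
Qed.

Lemma deg_gt0 X v : reflect (exists2 e, 0 < X e & v \in val e) (0 < deg X v).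
Proof.
rewrite degE lt0n sum_nat_eq0 negb_forall.
apply: (iffP existsP) => [[e]|[e Xe ve]]; last first.
  by exists e; rewrite ve -lt0n muln_gt0 Xe.
rewrite /= -lt0n muln_gt0 addn_gt0 !lt0b => /andP[Xe ve]; exists e => //.
by case/orP: ve => // /eqP ->; rewrite in_uv eqxx.
Qed.

(** Each occurrence of [v] in a closed walk is the tail of one edge and the head of one. *)
Lemma deg_walk w v : deg (walk_mgraph w) v = (count_mem v w).*2.
Proof.
rewrite degE; under eq_bigr do rewrite ffunE; rewrite sum_count_mem big_map.
under eq_bigr => p _ do rewrite in_uv loopP.
rewrite (eq_bigr (fun p : V * V => (p.1 == v) + (p.2 == v))); last first.
  by move=> [a b] _ /=; rewrite ![v == _]eq_sym; case: (a == v); case: (b == v).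
have sz : size w = size (rot 1 w) by rewrite size_rot.
rewrite big_split /= -addnn; congr (_ + _).
  rewrite -(big_map fst predT (fun a => (a == v) : nat)) -/(unzip1 _) unzip1_zip ?sz //.
  by rewrite -sum1_count [RHS]big_mkcond.
rewrite -(big_map snd predT (fun a => (a == v) : nat)) -/(unzip2 _) unzip2_zip ?sz //.
have <- : count_mem v (rot 1 w) = count_mem v w by apply/permP; rewrite perm_rot.
by rewrite -sum1_count [RHS]big_mkcond.
Qed.

Lemma mem_skip_repeated w : skip_repeated w =i w.
Proof. by move=> v; rewrite mem_rev mem_undup mem_rev. Qed.

Lemma uniq_skip_repeated w : uniq (skip_repeated w).
Proof. by rewrite rev_uniq undup_uniq. Qed.

Lemma skip_repeated_subseq w : subseq (skip_repeated w) w.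
Proof. by rewrite -[w in X in subseq _ X]revK subseq_rev undup_subseq. Qed.

Section Cost.
Variables (R : realFieldType) (I : instance R V).
Local Open Scope ring_scope.

Definition wcost w := \sum_(e <- walk_edges w) cost I e.

Lemma mcost_walk w : mcost I (walk_mgraph w) = wcost w.
Proof.
rewrite /mcost /wcost; under eq_bigr do rewrite ffunE.
elim: (walk_edges w) => [|y s IH]; first by rewrite big_nil big1.
rewrite big_cons -IH (bigD1 y) //= [in RHS](bigD1 y) //= eqxx mulrS -addrA.
by congr (_ + (_ + _)); apply: eq_bigr => x /negPf; rewrite eq_sym => ->.
Qed.

Lemma wcost_remove w1 x w2 : wcost (w1 ++ w2) <= wcost (w1 ++ x :: w2).
Proof.
(* Removing the first vertex also moves the closing edge, hence the separate case. *)
rewrite /wcost; case: w1 => [|y w1] /=.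
  case: w2 => [|z w2]; first by rewrite big_nil sumr_ge0 // => e _; apply: cost_ge0.
  rewrite !walk_edges_cons /= -!cats1 !pairmap_cat !(big_cons, big_cat, big_nil) /=.
  by rewrite [leRHS]addrCA lerD2l !addr0 [leRHS]addrC cost_triangle.
rewrite !walk_edges_cons !rcons_cat !pairmap_cat !big_cat /= lerD2l.
case: (rcons w2 y) => [|z s] /=; rewrite !(big_nil, big_cons).
  by rewrite addr0 cost_ge0.
by rewrite addrA lerD2r cost_triangle.
Qed.

Lemma wcost_subseq w1 w2 : subseq w1 w2 -> wcost w1 <= wcost w2.
Proof.
(* The fixed prefix [l] is there because the closing edge depends on the first vertex, so the cost
   does not split off the head. *)
suff: forall l, subseq w1 w2 -> wcost (l ++ w1) <= wcost (l ++ w2) by move=> h; apply: (h [::]).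
elim: w2 w1 => [|y w2 IH] w1 l; first by rewrite subseq0 => /eqP->.
case: w1 => [_|x w1] /=.
  by apply: le_trans (wcost_remove _ _ _); apply: IH; apply: sub0seq.
case: eqP => [->|_] sub12; first by rewrite -!cat_rcons; apply: IH.
by apply: le_trans (wcost_remove _ _ _); apply: IH.
Qed.

(** Both branches of [component_tour] become closed walks on lists without repetition, a single loop
    being the walk [[:: v]]. The loop sum in the bound pays for that branch. *)
Lemma component_tour_cycle F (S : {set V}) (H : mgraph V) :
  S \in comps F -> component_tour F S H ->
  exists q, [/\ uniq q, q =i S, H = walk_mgraph q
    & mcost I H <= 2%:R * (\sum_(e in forest_comp F S) cost I e)
                   + \sum_(v in S) cost I (loop v)].
Proof.
move=> SF; rewrite /component_tour; case: ifP => [S2 [w [wF ->]]|_ [v -> ->]]; last first.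
  exists [:: v]; split=> //; first by move=> u; rewrite !inE.
    by apply/ffunP => e; rewrite !ffunE /= addn0 eq_sym.
  have -> : [ffun e => nat_of_bool (e == loop v)] = walk_mgraph [:: v].
    by apply/ffunP => e; rewrite !ffunE /= addn0 eq_sym.
  rewrite mcost_walk /wcost walk_edges_cons /= big_seq1 big_set1 lerDr mulr_ge0 ?ler0n //.
  by rewrite sumr_ge0 // => e _; apply: cost_ge0.
exists (skip_repeated w); split=> //; first exact: uniq_skip_repeated.
- move=> v; rewrite mem_skip_repeated -has_pred1 has_count -double_gt0 -deg_walk.
  apply/deg_gt0/idP => [[e]|vS].
    rewrite wF double_gt0 lt0b inE => /andP[_ /subsetP eS] /eS //.
  case/imsetP: SF => u _ SE.
  (* A second vertex of [S] gives [v] an incident forest edge, so the walk along the doubled edges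
     visits [v]. *)
  have [z zS zv] : exists2 z, z \in S & v \notin [set z].
    case/card_gt1P: S2 => a [b [aS bS ab]].
    case: (eqVneq v a) => va; last by exists a; rewrite // inE.
    by exists b; rewrite // inE va.
  have : connect (adj F) v z.
    move: vS zS; rewrite SE !inE [connect _ u v]connect_adj_sym.
    exact: connect_trans.
  case/connectP=> -[|y p] /=; first by move=> _ zE; rewrite zE inE eqxx in zv.
  case/andP=> vy _ _; exists (uv v y); last by rewrite in_uv eqxx.
  rewrite wF double_gt0 lt0b inE [uv v y \in F]vy; apply/subsetP=> a.
  rewrite in_uv => /orP[] /eqP-> //; move: vS; rewrite SE !inE.
  by move/connect_trans; apply; apply: connect1.
rewrite mcost_walk (le_trans (wcost_subseq (skip_repeated_subseq w))) //.
rewrite -mcost_walk /mcost; under eq_bigr do rewrite wF.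
have -> : \sum_e cost I e *+ (e \in forest_comp F S).*2 =
   2%:R * \sum_(e in forest_comp F S) cost I e.
  rewrite mulr_sumr [RHS]big_mkcond; apply: eq_bigr => e _.
  by case: (_ \in _); rewrite ?mulr0n //= mulr_natl.
by rewrite lerDl sumr_ge0 // => v _; apply: cost_ge0.
Qed.

End Cost.

(** * Feasibility and cost of the union of the component tours *)

Section Assembly.
Variables (R : realFieldType) (I : instance R V).
Variables (F : {set edge V}) (S : 'I_(agents I) -> {set V}).
Variables (q : 'I_(agents I) -> seq V).
Hypothesis cardF : #|comps F| = agents I.
Hypothesis injS : injective S.
Hypothesis SF : [set S i | i : 'I_(agents I)] = comps F.
Hypothesis uniq_q : forall i, uniq (q i).
Hypothesis q_S : forall i, q i =i S i.

Let X : mgraph V := [ffun e =>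
  \sum_i walk_mgraph (q i) e + \sum_(v | e == loop v) (req I v - 1)].

Let Sclass i v : v \in S i -> S i = class F v.
Proof.
have : S i \in comps F by rewrite -SF imset_f.
case/imsetP=> u _ ->; rewrite inE => uv; apply/eqP.
by rewrite (@class_eq _ F u v).
Qed.

Let S_of v : exists i, v \in S i.
Proof.
have : class F v \in comps F by apply: imset_f.
rewrite -SF => /imsetP[i _ E]; exists i; rewrite -E inE; exact: connect0.
Qed.

Let S_conn i u v : u \in S i -> v \in S i -> connect (adj F) u v.
Proof. by move=> /Sclass E; rewrite E inE. Qed.

Let S_closed i u v : u \in S i -> connect (adj F) u v -> v \in S i.
Proof. by move=> /Sclass -> uv; rewrite inE. Qed.

Lemma sum_parts (M : nmodType) (f : V -> M) :
  (\sum_i \sum_(v in S i) f v = \sum_v f v)%R.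
Proof.
under eq_bigr do rewrite big_mkcond; rewrite exchange_big; apply: eq_bigr => v _ /=.
have [i vi] := S_of v; rewrite (bigD1 i) //= vi big1 ?addr0 // => j j_i.
case: ifP => // vj; case/eqP: j_i; apply: injS.
by rewrite (Sclass vi) (Sclass vj).
Qed.

Let walk_gt0 i e : 0 < walk_mgraph (q i) e -> val e \subset S i.
Proof.
rewrite ffunE -has_count has_pred1 => /walk_edges_mem[u [v [ui vi ->]]].
by apply/subsetP=> a; rewrite in_uv -!q_S => /orP[]/eqP->.
Qed.

Let X_gt0 e : 0 < X e -> exists i, val e \subset S i.
Proof.
rewrite ffunE addn_gt0 => /orP[]; rewrite lt0n sum_nat_eq0 negb_forall.
  by case/existsP=> i; rewrite -lt0n => /walk_gt0; exists i.
case/existsP=> v; rewrite negb_imply => /andP[/eqP-> _].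
have [i vi] := S_of v; exists i.
by apply/subsetP=> a; rewrite in_uv orbb => /eqP->.
Qed.

(** The cycle of its component visits [v] once, and the added loops visit it [req I v - 1] times; as
    requests are positive, the truncated subtraction is exact. *)
Let deg_X v : deg X v = (req I v).*2.
Proof.
rewrite degE; under eq_bigr do rewrite ffunE mulnDl.
rewrite big_split /=; under eq_bigr do rewrite big_distrl /=.
rewrite exchange_big /=; under eq_bigr do rewrite -degE deg_walk count_uniq_mem // q_S.
have [i vi] := S_of v.
rewrite (bigD1 i) //= vi big1 ?addn0; last first.
  move=> j j_i; case: (boolP (v \in S j)) => // vj; case/eqP: j_i; apply: injS.
  by rewrite (Sclass vi) (Sclass vj).
have -> : \sum_e (\sum_(u | e == loop u) (req I u - 1)) * ((v \in val e) + (e == loop v))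
   = (req I v - 1).*2.
  under eq_bigr do rewrite big_mkcond big_distrl /=.
  rewrite exchange_big /= (bigD1 v) //= [X in _ + X]big1 ?addn0; last first.
    move=> u u_v; rewrite big1 // => e _; case: eqP => // ->.
    by rewrite in_uv loopP orbb andbb [v == u]eq_sym (negPf u_v) muln0.
  rewrite (bigD1 (loop v)) //= eqxx in_uv eqxx big1 ?addn0; first by rewrite muln2.
  by move=> e /negPf->.
by have := req_gt0 I v; lia.
Qed.

Let in_supp_restrict i e : e \in walk_edges (q i) -> e \in supp (restrict X (S i)).
Proof.
move=> eq; have Xe : 0 < walk_mgraph (q i) e by rewrite ffunE -has_count has_pred1.
rewrite inE ffunE walk_gt0 // ffunE addn_gt0; apply/orP; left.
by rewrite (bigD1 i) //= addn_gt0 Xe.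
Qed.

Let connect_restrict i u v : u \in S i -> v \in S i ->
  connect (adj (supp (restrict X (S i)))) u v.
Proof.
rewrite -!q_S; apply: connect_cycle; rewrite cycle_adj.
by apply/allP => e /in_supp_restrict.
Qed.

(** An edge of [X] stays within one [S i], and the cycle [q i] connects all of [S i]. So [X] and [F]
    have the same components although shortcuts may use edges outside [F]. *)
Let connect_X : connect (adj (supp X)) =2 connect (adj F).
Proof.
move=> u v; apply/idP/idP; apply: connect_sub => {u v} u v; rewrite /adj.
  rewrite inE => /X_gt0[i /subsetP Si]; apply: (@S_conn i); apply: Si;
  by rewrite in_uv eqxx ?orbT.
move=> uvF; have [i ui] := S_of u.
have vi : v \in S i by apply: S_closed ui _; apply: connect1.
have := connect_restrict ui vi; apply: connect_sub => a b; rewrite /adj inE ffunE.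
by case: ifP => // _ ab; apply: connect1; rewrite /adj inE.
Qed.

Lemma assembly_feasible : feasible I X.
Proof.
split.
- by move=> v; rewrite deg_X odd_double.
- by move=> v; rewrite /visits deg_X doubleK.
- by rewrite (comps_eq connect_X).
rewrite (comps_eq connect_X) -SF => _ /imsetP[i _ ->].
(* No edge of [X] joins different [S i], so restricting to [S i] keeps the degrees inside it. *)
have degr v : deg (restrict X (S i)) v = if v \in S i then deg X v else 0.
  rewrite !degE; case: ifP => vi; last first.
    rewrite big1 // => e _; rewrite ffunE; case: ifP => // /subsetP eS.
    case: (boolP (v \in val e)) => [/eS|ve]; first by rewrite vi.
    rewrite add0n; case: eqP ve => [->|]; last by rewrite muln0.
    by rewrite in_uv eqxx.
  apply: eq_bigr => e _; rewrite ffunE; case: ifP => // eS.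
  case: (posnP (X e)) => [->//|/X_gt0[j /subsetP ej]].
  have ve : v \notin val e.
    apply/negP=> /ej vj; move/negP: eS; apply.
    by apply/subsetP=> a /ej; rewrite (Sclass vi) (Sclass vj).
  rewrite (negPf ve) mul0n; case: eqP ve => [->|]; last by rewrite muln0.
  by rewrite in_uv eqxx.
split; first split.
- by move=> v; rewrite degr; case: ifP; rewrite // deg_X odd_double.
- move=> u v; rewrite !inE !degr; case: ifP => // ui _; case: ifP => // vi _.
  exact: connect_restrict.
have : S i \in comps F by rewrite -SF imset_f.
case/imsetP=> u _ E; have ui : u \in q i by rewrite q_S E inE connect0.
have : 0 < size (walk_edges (q i)) by rewrite size_walk_edges; case: (q i) ui.
case Ew: (walk_edges (q i)) => [|e s] // _; exists e.
have : e \in supp (restrict X (S i)) by apply: in_supp_restrict; rewrite Ew inE eqxx.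
by rewrite inE.
Qed.

Local Open Scope ring_scope.

Lemma assembly_cost :
    (forall i, mcost I (walk_mgraph (q i)) <=
       2%:R * (\sum_(e in forest_comp F (S i)) cost I e)
       + \sum_(v in S i) cost I (loop v)) ->
  mcost I X <=
    2%:R * (\sum_(e in F) cost I e) + \sum_v cost I (loop v) *+ req I v.
Proof.
move=> cost_q; rewrite /mcost; under eq_bigr do rewrite ffunE mulrnDr -[X in X + _]sumrMnr.
rewrite big_split /= exchange_big /=.
have -> : \sum_e cost I e *+ (\sum_(v | e == loop v) (req I v - 1))%N =
    \sum_v cost I (loop v) *+ (req I v - 1).
  under eq_bigr do rewrite -sumrMnr big_mkcond.
  rewrite exchange_big; apply: eq_bigr => v _ /=.
  by rewrite (bigD1 (loop v)) //= eqxx big1 ?addr0 // => e /negPf->.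
(* One of the [req I v] loop charges at each vertex is set aside for the loop sum in the bound on
   its component's tour. *)
have -> : \sum_v cost I (loop v) *+ req I v =
    \sum_i \sum_(v in S i) cost I (loop v) + \sum_v cost I (loop v) *+ (req I v - 1).
  rewrite sum_parts -big_split; apply: eq_bigr => v _ /=.
  by rewrite -mulrS subn1 prednK ?req_gt0.
rewrite addrA lerD2r; apply: (le_trans (ler_sum _ (fun i _ => cost_q i))).
rewrite big_split /= lerD2r -mulr_sumr ler_wpM2l ?ler0n //.
rewrite (eq_bigr (fun i => \sum_e if e \in forest_comp F (S i) then cost I e else 0));
  last by move=> i _; rewrite big_mkcond.
(* An edge of [F] belongs to [forest_comp F (S i)] for at most one [i]. *)
rewrite exchange_big /= [leRHS]big_mkcond; apply: ler_sum => e _; case: ifP => eF; last first.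
  by rewrite big1 // => i _; rewrite inE eF.
have [u [v ee]] := edgeP e; have [i ui] := S_of u.
have ue : u \in val e by rewrite ee in_uv eqxx.
rewrite (bigD1 i) //= big1 ?addr0 => [|j j_i]; first by case: ifP; rewrite ?cost_ge0.
rewrite inE; case: (boolP (val e \subset S j)) => [/subsetP/(_ u ue) uj|]; last by rewrite andbF.
by case/eqP: j_i; apply: injS; rewrite (Sclass ui) (Sclass uj).
Qed.

End Assembly.
End Walks.

(** * Existence of an optimum and lower bounds on it *)

Section Optimum.
Variables (R : realFieldType) (V : finType) (I : instance R V).
Implicit Types (X : mgraph V).

Definition feasibleb X : bool :=
  [&& [forall v, ~~ odd (deg X v)], [forall v, visits X v == req I v],
      #|comps (supp X)| == agents I
    & [forall S in comps (supp X),
        [&& [forall v, ~~ odd (deg (restrict X S) v)],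
            [forall u in verts (restrict X S), forall v in verts (restrict X S),
               connect (adj (supp (restrict X S))) u v]
          & [exists e, 0 < restrict X S e]]]].

Lemma feasibleP X : reflect (feasible I X) (feasibleb X).
Proof.
apply: (iffP and4P) => [[/forallP h1 /'forall_eqP h2 /eqP h3 /forall_inP h4]|[h1 h2 h3 h4]].
  split=> // S /h4 /and3P[/forallP ev /forall_inP cn /existsP ne].
  by split=> //; split=> // u v ui vi; apply: (forall_inP (cn u ui)).
split; [exact/forallP | exact/'forall_eqP | exact/eqP |].
apply/forall_inP=> S /h4 [[ev cn] ne]; apply/and3P; split; [exact/forallP | |exact/existsP].
by apply/forall_inP=> u ui; apply/forall_inP=> v vi; apply: cn.
Qed.

Lemma feasible_deg X v : feasible I X -> deg X v = (req I v).*2.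
Proof. by case=> ev vis _ _; rewrite -vis /visits even_halfK. Qed.

(** A multiplicity is at most the degree of an end, which is twice a request. Hence feasible
    solutions embed in a finite function type, over which the minimum can be taken. *)
Lemma feasible_bound X e : feasible I X -> X e < (total_req I).*2.+1.
Proof.
move=> feasX; have [u [v ee]] := edgeP e.
rewrite ltnS (@leq_trans (deg X u)) //.
  have ue : u \in val e by rewrite ee in_uv eqxx.
  by rewrite degE (bigD1 e) //= ue mulnDr muln1 -addnA leq_addr.
rewrite feasible_deg // leq_double /total_req (bigD1 u) //=; exact: leq_addr.
Qed.

Lemma opt_exists X : feasible I X -> exists opt, is_opt I opt.
Proof.
move=> feasX; pose N := (total_req I).*2.+1.
pose dec (f : {ffun edge V -> 'I_N}) : mgraph V := [ffun e => val (f e)].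
pose enc (Y : mgraph V) : {ffun edge V -> 'I_N} := [ffun e => inord (Y e)].
have encK Y : feasible I Y -> dec (enc Y) = Y.
  by move=> fY; apply/ffunP => e; rewrite !ffunE /= inordK // feasible_bound.
have decX : feasibleb (dec (enc X)) by rewrite encK //; apply/feasibleP.
case: (arg_minP (fun f => mcost I (dec f)) (P := fun f => feasibleb (dec f)) decX).
move=> f /feasibleP feasf minf; exists (mcost I (dec f)); split; first by exists (dec f).
by move=> Y feasY; rewrite -[Y]encK //; apply: minf; apply/feasibleP; rewrite encK.
Qed.

Local Open Scope ring_scope.

Lemma loops_cost X : feasible I X ->
  \sum_v cost I (loop v) *+ req I v <= 2%:R * mcost I X.
Proof.
move=> feasX.
have : \sum_v cost I (loop v) *+ deg X v <= 4%:R * mcost I X.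
  under eq_bigr do rewrite degE -sumrMnr.
  rewrite exchange_big mulr_sumr /=; apply: ler_sum => e _.
  under eq_bigr do rewrite mulnC mulrnA.
  rewrite sumrMnl mulrnAr lerMn2r; apply/orP; right; have [u [v ->]] := edgeP e.
  case: (eqVneq u v) => [<-|u_v].
    (* A loop counts twice at its only end, so its share is twice its cost, within the factor 4. *)
    rewrite (bigD1 u) // in_uv !eqxx big1 /= => [|w /negPf w_u].
      have := cost_ge0 I (loop u); rewrite addr0 -[uv u u]/(loop u); lra.
    by rewrite !inE w_u loopP eq_sym w_u.
  rewrite (bigD1 u) // (bigD1 v) /=; last by rewrite eq_sym.
  rewrite !inE !loopP !eqxx [v == u]eq_sym (negPf u_v) /=.
  rewrite big1 => [|w /andP[/negPf w_u /negPf w_v]]; last first.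
    by rewrite !inE w_u w_v loopP eq_sym w_u.
  rewrite addr0 !mulr1n; have := cost_loop I u_v; have := cost_loop I (v := u) (u := v).
  rewrite eq_sym u_v uvC => /(_ isT); lra.
under eq_bigr do rewrite feasible_deg // -muln2 mulrnA.
rewrite sumrMnl -mulr_natr; lra.
Qed.

Lemma min_forest_cost X F : feasible I X -> min_spanning_forest I F ->
  \sum_(e in F) cost I e <= mcost I X.
Proof.
move=> [_ _ cX _] [_ minF]; have [F' [F'X forF' EF']] := spanning_subforest (supp X).
apply: le_trans (minF F' _) _; first by split; rewrite // (comps_eq EF').
rewrite /mcost big_mkcond; apply: ler_sum => e _; case: ifP => [/(subsetP F'X)|_].
  by rewrite inE => Xe; rewrite -(prednK Xe) mulrS lerDl mulrn_wge0 ?cost_ge0.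
by rewrite mulrn_wge0 ?cost_ge0.
Qed.

End Optimum.

(** Each vertex adds its loops to exactly one of the tours, so their union does not depend on
    [pick]. *)
Lemma sum_add_loops (R : realFieldType) (V : finType) (I : instance R V)
    (H : 'I_(agents I) -> mgraph V) (pick : V -> 'I_(agents I)) :
  [ffun e => \sum_i add_loops I H pick i e] =
  [ffun e => \sum_i H i e + \sum_(v | e == loop v) (req I v - 1)].
Proof.
apply/ffunP=> e; rewrite ffunE [RHS]ffunE.
transitivity (\sum_i (H i e +
    \sum_(v | (pick v == i) && (e == loop v)) (req I v - 1))).
  by apply: eq_bigr => i _; rewrite ffunE.
rewrite big_split /=; congr (_ + _).
rewrite [RHS]big_mkcond; under eq_bigr do rewrite big_mkcond; rewrite exchange_big.
apply: eq_bigr => v _ /=; rewrite (bigD1 (pick v)) //= eqxx big1 ?addn0 // => i.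
by rewrite eq_sym => /negPf->.
Qed.

Lemma alg_run_approx (R : realFieldType) (V : finType) (I : instance R V)
    (res : option (mgraph V)) :
  alg_run I res ->
  ((~ exists Y, feasible I Y) -> res = None) /\
  ((exists Y, feasible I Y) ->
     exists X opt,
       [/\ res = Some X, feasible I X, is_opt I opt
         & (mcost I X <= 4%:R * opt)%R]).
Proof.
case=> [Vm|F S H pick mV minF injS SF HF _].
  split=> // -[Y [_ _ cY _]]; have := card_comps_leq (supp Y).
  by rewrite cY leqNgt Vm.
have mem_comps i : S i \in comps F by rewrite -SF imset_f.
have tour_cycle i := component_tour_cycle I (mem_comps i) (HF i).
have [q qP] := fin_all_exists tour_cycle.
have uniq_q i : uniq (q i) by have [] := qP i.
have q_S i : q i =i S i by have [] := qP i.
have HE i : H i = walk_mgraph (q i) by have [] := qP i.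
have cardF : #|comps F| = agents I by have [[]] := minF.
set X := (X in Some X).
have XE : X = [ffun e => \sum_i walk_mgraph (q i) e +
                         \sum_(v | e == loop v) (req I v - 1)].
  rewrite /X sum_add_loops; apply/ffunP=> e; rewrite ffunE [RHS]ffunE; congr (_ + _).
  by apply: eq_bigr => i _; rewrite HE.
have feasX : feasible I X by rewrite XE; apply: assembly_feasible injS SF uniq_q q_S.
(* A run that returns a graph returns a feasible one, so an infeasible instance leaves only NO. *)
split=> [noX|_]; first by case: noX; exists X.
have [opt optP] := opt_exists feasX; exists X, opt; split=> //.
have [[Y feasY <-] _] := optP.
have := loops_cost feasY; have := min_forest_cost feasY minF.
have : (mcost I X <= 2%:R * (\sum_(e in F) cost I e)
    + \sum_v cost I (loop v) *+ req I v)%R.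
  rewrite XE; apply: (assembly_cost injS SF) => i.
  by rewrite -HE; have [] := qP i.
lra.
Qed.

(** * Prim's tree and the cyclic lists *)

(** The threshold counts say that in sorted order the k-th element of [A] costs at most the k-th of
    [B]. Instead of sorting, the induction removes a most expensive element from each set. *)
Lemma sum_dominance (R : realFieldType) (T : finType) (c : T -> R) (A B : {set T}) :
    #|A| = #|B| ->
    (forall th, #|[set b in B | (c b <= th)%R]| <= #|[set a in A | (c a <= th)%R]|) ->
  (\sum_(a in A) c a <= \sum_(b in B) c b)%R.
Proof.
have [n leBn] := ubnP #|B|; elim: n A B leBn => // n IH A B leBn AB dom.
have [B0|[b0 b0B]] := set_0Vmem B.
  move: AB; rewrite B0 cards0 => /eqP; rewrite cards_eq0 => /eqP->.
  by rewrite !big_set0.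
have [a0 a0A] : exists a, a \in A.
  by apply/set0Pn; rewrite -card_gt0 AB card_gt0; apply/set0Pn; exists b0.
have exmax (D : {set T}) d0 : d0 \in D ->
    exists2 d, d \in D & forall x, x \in D -> (c x <= c d)%R.
  by move=> d0D; case: (arg_maxP (P := mem D) c d0D) => d dD dmax; exists d.
have [a aA amax] := exmax A a0 a0A; have [b bB bmax] := exmax B b0 b0B.
have setT_le (D : {set T}) d th : (forall x, x \in D -> (c x <= c d)%R) -> (c d <= th)%R ->
    [set x in D | (c x <= th)%R] = D.
  move=> dmax dth; apply/setP=> x; rewrite inE.
  by case: (boolP (x \in D)) => //= /dmax /le_trans->.
have cab : (c a <= c b)%R.
  have := dom (c b); rewrite (setT_le B b) // -AB => h.
  have /setP/(_ a) : [set x in A | (c x <= c b)%R] = A.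
    by apply/eqP; rewrite eqEcard h andbT; apply/subsetP=> x; rewrite inE => /andP[].
  by rewrite inE aA.
rewrite (big_setD1 a aA) (big_setD1 b bB) /= lerD //; apply: IH.
- by move: leBn; rewrite (cardsD1 b B) bB.
- by move: AB; rewrite (cardsD1 a A) (cardsD1 b B) aA bB => -[].
move=> th; have := dom th.
have cardD (D : {set T}) d : d \in D ->
    #|[set x in D | (c x <= th)%R]| = (c d <= th)%R + #|[set x in D :\ d | (c x <= th)%R]|.
  move=> dD; rewrite (cardsD1 d) inE dD /=; congr (_ + #|pred_of_set _|).
  by apply/setP=> x; rewrite !inE andbA.
case: (lerP (c a) th) => ath; last first.
  by rewrite (cardD A a aA) (cardD B b bB) !lt_geF // (lt_le_trans ath).
case: (lerP (c b) th) => bth.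
  by rewrite (cardD A a aA) (cardD B b bB) ath bth.
(* Here c a <= th < c b: all of [A] without [a] lies below the threshold, and it has as many
   elements as [B] without [b]. *)
move=> _; rewrite (@setT_le (A :\ a) a) //; last first.
  by move=> x /setD1P[_]; apply: amax.
have -> : #|A :\ a| = #|B :\ b|.
  by move: AB; rewrite (cardsD1 a A) (cardsD1 b B) aA bB => -[].
by apply/subset_leq_card/subsetP=> x; rewrite inE => /andP[].
Qed.

(** * Forests given by an order of insertion and parents *)

Section Prim.
Variables (R : realFieldType) (V : finType) (I : instance R V).
Variables (r : V) (o : seq V) (par : V -> V) (K : {set V}).
Implicit Types (u v w x y : V) (e : edge V) (p P Q : seq V).

(** Tree edges are named by their child, so a choice of edges is a set [K] of vertices other than
    the root. *)
Definition te v : edge V := uv v (par v).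

Definition kept_forest : {set edge V} := te @: K.

Hypothesis uniq_o : uniq o.
Hypothesis mem_o : forall v, v \in o.
Hypothesis head_o : ohead o = Some r.
Hypothesis par_before : forall P v Q, o = P ++ v :: Q -> P != [::] -> par v \in P.
Hypothesis rK : r \notin K.

Let F := kept_forest.

Lemma head_prefix P Q : o = P ++ Q -> P != [::] -> r \in P.
Proof.
by move: head_o => + oE; rewrite oE; case: P {oE} => //= y P [->]; rewrite inE eqxx.
Qed.

Lemma fresh P v Q : o = P ++ v :: Q -> v \notin P.
Proof. by move=> oE; move: uniq_o; rewrite oE uniq_catC /= mem_cat negb_or => /andP[/andP[]]. Qed.

Lemma root_first P v Q : o = P ++ v :: Q -> (P == [::]) = (v == r).
Proof.
move=> oE; apply/eqP/eqP => [P0|vr].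
  by move: head_o; rewrite oE P0 => -[].
apply/eqP; apply: contraT => /(head_prefix oE) rP.
by have := fresh oE; rewrite vr rP.
Qed.

Lemma par_prefix P Q v : o = P ++ Q -> v \in P -> v != r -> par v \in P.
Proof.
move=> oE vP vr; case/splitPr: vP oE => P1 P2; rewrite -catA => oE.
by rewrite mem_cat (par_before oE) // (root_first oE).
Qed.

Lemma K_neq_root v : v \in K -> v != r.
Proof. by apply: contraTneq => ->. Qed.

Lemma index_par v : v != r -> index (par v) o < index v o.
Proof.
move=> vr; have := mem_o v; case/splitPr: {2}o / (mem_o v) (erefl o) => P Q oE _.
have vP := fresh oE; rewrite oE !index_cat (negPf vP) /= eqxx addn0.
by rewrite (par_before oE) ?(root_first oE) // index_mem (par_before oE) ?(root_first oE).
Qed.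

Definition up v := if v \in K then par v else v.
(** The root of the kept tree containing [v]. Each step to a parent moves towards the front of [o],
    so [size o] steps reach a fixed point of [up]. *)
Definition rt v := iter (size o) up v.

Lemma rt_root v : v \notin K -> rt v = v.
Proof. by move=> vK; apply: iter_fix; rewrite /up (negPf vK). Qed.

Lemma rt_notin v : rt v \notin K.
Proof.
rewrite /rt; have : index v o <= size o by apply: index_size.
elim: (size o) v => [|n IH] v.
  rewrite leqn0 => /eqP v0 /=; case: o head_o v0 => //= y s [->].
  by case: eqP => // <-.
move=> vn; rewrite iterSr; case: (boolP (v \in K)) => vK; last first.
  by rewrite /up (negPf vK) iter_fix // /up (negPf vK).
rewrite {2}/up vK; apply: IH; rewrite -ltnS.
exact: leq_trans (index_par (K_neq_root vK)) vn.
Qed.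

Lemma rt_par v : v \in K -> rt (par v) = rt v.
Proof.
move=> vK; have upv : up v = par v by rewrite /up vK.
by rewrite -upv /rt -iterSr iterS {1}/up (negPf (rt_notin v)).
Qed.

Lemma rt_prefix P Q v : o = P ++ Q -> v \in P -> rt v \in P.
Proof.
move=> oE vP; rewrite /rt; elim: (size o) => //= n; set u := iter n up v => uP.
by rewrite /up; case: ifP => // /K_neq_root; apply: par_prefix oE uP.
Qed.

(** [rt] is constant along kept edges, and every vertex is joined to its [rt]; so it labels the
    components. *)
Lemma connect_kept u v : connect (adj F) u v = (rt u == rt v).
Proof.
have step x y : adj F x y -> rt x = rt y.
  case/imsetP=> w wK /eqP; rewrite uv_eq => /orP[] /andP[/eqP-> /eqP->];
  by rewrite rt_par.
have to_root x : connect (adj F) x (rt x).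
  rewrite /rt; elim: (size o) => //= n IH; apply: connect_trans IH _.
  rewrite {2}/up; case: ifP => // zK; apply: connect1; exact: imset_f.
apply/idP/eqP => [/connectP[p]|uv].
  by elim: p u => [|w p IH] u /= => [_ ->|/andP[/step-> /IH]].
by apply: connect_trans (to_root u) _; rewrite uv connect_adj_sym.
Qed.

Definition rclass x : {set V} := [set v | rt v == x].

Lemma comps_kept : comps F = rclass @: ~: K.
Proof.
apply/setP=> S; apply/imsetP/imsetP => [[u _ ->]|[x xK ->]].
  exists (rt u); first by rewrite inE rt_notin.
  by apply/setP=> w; rewrite !inE connect_kept eq_sym.
exists x => //; apply/setP=> w; rewrite !inE connect_kept.
by rewrite [rt x]rt_root 1?eq_sym //; move: xK; rewrite inE.
Qed.

Lemma rclass_inj : {in ~: K &, injective rclass}.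
Proof.
move=> x y; rewrite !inE => xK yK /setP/(_ x).
by rewrite !inE rt_root // eqxx => /esym/eqP.
Qed.

Lemma card_comps_kept : #|comps F| = #|~: K|.
Proof. by rewrite comps_kept card_in_imset //; exact: rclass_inj. Qed.

(** Injectivity of [te] on [K] comes from counting: [~: K] counts the components, and reaching so
    few takes at least [#|K|] edges. *)
Lemma card_kept : #|F| = #|K|.
Proof.
apply/eqP; rewrite eqn_leq leq_imset_card /=.
have := card_comps_geq F; rewrite card_comps_kept -(cardsC K).
by rewrite leq_add2r.
Qed.

Lemma kept_is_forest : is_forest F.
Proof.
apply: card_forest => [e /imsetP[v vK ->]|].
  rewrite uv_card; case: eqP => // vE.
  by have := index_par (K_neq_root vK); rewrite -vE ltnn.
by rewrite card_kept card_comps_kept cardsC.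
Qed.

(** * Minimality of the kept forest *)

Section Minimality.

Let c v : R := cost I (te v).

Hypothesis prim : forall P v Q, o = P ++ v :: Q -> P != [::] ->
  forall u w, u \in P -> w \notin P -> (c v <= cost I (uv u w))%R.
Hypothesis kept : forall v w, v \in K -> w \notin K -> w != r -> (c v <= c w)%R.
Hypothesis cardK : #|K| + agents I = #|V|.

Let light (th : R) : {set edge V} := [set e | (cost I e <= th)%R].
Let low th : {set V} := [set v | (v != r) && (c v <= th)%R].

(* Prim's tree is a bottleneck tree: its edges of cost at most th connect
   whatever all edges of cost at most th connect. *)
Lemma prim_bottleneck th u v :
  connect (adj (light th)) u v -> connect (adj (te @: low th)) u v.
Proof.
set T := te @: low th.
suff H P Q : o = P ++ Q -> {in P &, forall x y,
    connect (adj (light th)) x y -> connect (adj T) x y}.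
  by apply: (H o [::]); rewrite ?cats0.
elim/last_ind: P Q => [|P z IH] Q; first by [].
rewrite cat_rcons => oE.
have key y : y \in P -> connect (adj (light th)) y z -> connect (adj T) y z.
  move=> yP yz; have Pn0 : P != [::] by case: (P) yP.
  have zP := fresh oE.
  (* A light walk from [y] leaves the prefix by a light edge. So the edge that Prim chose for [z] is
     light too, and it leads back into the prefix. *)
  have [||a [b [aP bP ab]]] := @connect_exit _ _ [set x in P] _ _ yz; rewrite ?inE //.
  have czth : (c z <= th)%R.
    move: aP bP ab; rewrite /adj !inE => aP bP.
    exact: le_trans (prim oE Pn0 aP bP).
  have zr : z != r by rewrite -(root_first oE).
  have parP := par_before oE Pn0.
  have zp : connect (adj (light th)) z (par z) by apply: connect1; rewrite /adj inE.
  apply: connect_trans (IH _ oE y (par z) yP parP (connect_trans yz zp)) _.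
  rewrite connect_adj_sym; apply: connect1; apply/imsetP; exists z => //.
  by rewrite inE zr.
move=> x y; rewrite !mem_rcons !inE => /orP[/eqP->|xP] /orP[/eqP->|yP] xy //.
- by rewrite connect_adj_sym key // connect_adj_sym.
- exact: key.
- exact: IH oE x y xP yP xy.
Qed.

Lemma kept_min_forest : min_spanning_forest I F.
Proof.
have cardC : #|~: K| = agents I by move: cardK; rewrite -(cardsC K) => /addnI.
split; first by split; [exact: kept_is_forest | rewrite card_comps_kept].
move=> F' [forF' cF'].
have cardF' : #|F| = #|F'|.
  have := forest_card forF'; rewrite card_kept cF' -cardK => /addIn //.
apply: sum_dominance => // th.
set F'th := [set b in F' | _].
(* The light tree edges leave at most as many components as the light part of [F'], which is a
   forest; so there are at least as many of them. *)
have F'low : #|F'th| <= #|low th|.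
  have forF'th : is_forest F'th.
    by apply: forest_sub forF' _; apply/subsetP=> e; rewrite inE => /andP[].
  have : #|comps (te @: low th)| <= #|comps F'th|.
    apply: card_comps_mono => u v uv; apply: prim_bottleneck; move: uv.
    apply: connect_sub => a b ab; apply: connect1; move: ab.
    by rewrite /adj !inE => /andP[].
  have := card_comps_geq (te @: low th); rewrite -(forest_card forF'th).
  move=> h1 h2; rewrite -(leq_add2r #|comps F'th|); apply: leq_trans h1 _.
  exact: leq_add (leq_imset_card _ _) h2.
have injte : {in K &, injective te} by apply/imset_injP; rewrite -card_kept.
have -> : [set a in F | (cost I a <= th)%R] = te @: (K :&: low th).
  apply/setP=> e; rewrite inE; apply/andP/imsetP => [[/imsetP[v vK ->] cv]|[v]].
    by exists v; rewrite // !inE vK K_neq_root.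
  by rewrite !inE => /and3P[vK _ cv] ->; rewrite imset_f.
rewrite card_in_imset; last by move=> u v /setIP[uK _] /setIP[vK _]; apply: injte.
(* If all light tree edges are kept, the previous bound applies. Otherwise a light one was dropped,
   no kept edge is more expensive, and the whole of [F] is light. *)
case: (boolP (low th \subset K)) => [/setIidPr-> //|/subsetPn[w]].
rewrite inE => /andP[wr cw] wK.
have -> : K :&: low th = K.
  apply/setIidPl/subsetP=> v vK; rewrite inE K_neq_root //=.
  exact: le_trans (kept vK wK wr) cw.
rewrite -card_kept cardF'; apply/subset_leq_card/subsetP=> e.
by rewrite inE => /andP[].
Qed.

End Minimality.

(** * Cyclic lists as shortcuts of Euler walks *)

Section Tours.
Implicit Types (nx : V -> V) (q : seq V).

(** Unlike [walk_edges] it has no closing edge: the walks below end at their first vertex. *)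
Definition path_edges (w : seq V) : seq (edge V) :=
  if w is x :: p then pairmap (@uv V) x p else [::].

Lemma path_edges_cat (w1 : seq V) x (w2 : seq V) :
  path_edges (w1 ++ x :: w2) = path_edges (rcons w1 x) ++ path_edges (x :: w2).
Proof.
case: w1 => [|y w1] //=; rewrite pairmap_cat -cats1 pairmap_cat /= -catA.
by [].
Qed.

(* Where v is new, the walk that visits it from the first occurrence of a is
   shortcut to the old cycle with v inserted after a. *)
Lemma skip_repeated_insert (w1 w2 : seq V) a v : a \notin w1 -> v \notin w1 ++ a :: w2 ->
  exists A B : seq V, skip_repeated (w1 ++ a :: w2) = A ++ a :: B /\
    skip_repeated (w1 ++ [:: a, v, a & w2]) = A ++ [:: a, v & B].
Proof.
move=> aw1; rewrite mem_cat inE !negb_or => /and3P[vw1 v_a vw2].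
exists (rev (undup (rev w1))), (rev [seq x <- undup (rev w2) | x \notin a :: rev w1]).
rewrite /skip_repeated !rev_cat !rev_cons -!cats1 -!catA !undup_cat /=.
rewrite !mem_rev (negPf aw1) /= [v \in _]inE mem_rev (negPf v_a) (negPf vw1) /=.
have -> : [seq x <- undup (rev w2) | x \notin [:: a, v, a & rev w1]] =
    [seq x <- undup (rev w2) | x \notin a :: rev w1].
  apply: eq_in_filter => x; rewrite mem_undup mem_rev !inE => xw2.
  have /negPf-> : x != v by apply: contraNneq vw2 => <-.
  by case: (x == a).
rewrite inE [a \in a :: _]inE eqxx orbT /= !rev_cat !rev_cons -!cats1 -!catA.
by [].
Qed.

Definition follows nx q := map nx q = rot 1 q.

Lemma follows_insert nx nx' A a v B :
    follows nx (A ++ a :: B) -> nx' a = v -> nx' v = nx a ->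
    {in A ++ B, nx' =1 nx} ->
  follows nx' (A ++ [:: a, v & B]).
Proof.
move=> + nx'a nx'v nx'E; have eA : map nx' A = map nx A.
  by apply/eq_in_map => x xA; rewrite nx'E // mem_cat xA.
have eB : map nx' B = map nx B.
  by apply/eq_in_map => x xB; rewrite nx'E // mem_cat xB orbT.
rewrite /follows !map_cat /= nx'a nx'v eA eB; case: A {nx'E eA} => [|x A].
  by rewrite /= !rot1_cons /= => ->.
rewrite /= !rot1_cons !rcons_cat /= -!cat_cons -[A ++ a :: _]cat_rcons => /eqP.
rewrite eqseq_cat; last by rewrite /= size_map size_rcons.
by case/andP=> /eqP-> /eqP->; rewrite cat_rcons.
Qed.

(** Invariant of the linking phase for the inserted prefix [P]. The walk [w] around the doubled kept
    edges inside [P] exists only in the proof; the memory holds its shortcut as the pointers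
    [nx]. *)
Definition tours P nx : Prop := forall x, x \in P -> x \notin K ->
  exists w : seq V, [/\ ohead w = Some x /\ last x w = x,
    forall v, (v \in w) = (v \in P) && (rt v == x),
    forall e, count_mem e (path_edges w) =
      (e \in te @: [set v in K | (v \in P) && (rt v == x)]).*2
    & follows nx (skip_repeated w)].

Lemma tours_root P v Q nx nx' : o = P ++ v :: Q -> v \notin K ->
    nx' v = v -> (forall u, u != v -> nx' u = nx u) ->
  tours P nx -> tours (rcons P v) nx'.
Proof.
move=> oE vK nx'v nx'E toursP x; have vP := fresh oE.
have same_sets y : y != v -> forall u,
    (u \in rcons P v) && (rt u == y) = (u \in P) && (rt u == y).
  move=> yv u; rewrite mem_rcons inE; case: eqP => //= ->.
  by rewrite rt_root // eq_sym (negPf yv) andbF.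
rewrite mem_rcons inE; case: eqVneq => [-> _ _|xv /= xP xK].
  have only_v u : (u \in rcons P v) && (rt u == v) = (u == v).
    rewrite mem_rcons inE; case: eqP => [->|_] /=; first by rewrite rt_root ?eqxx.
    apply/negP=> /andP[uP /eqP uv].
    by have := rt_prefix oE uP; rewrite uv (negPf vP).
  exists [:: v]; split=> //.
  - by move=> u; rewrite only_v inE.
  - move=> e; rewrite /=; case: imsetP => // -[u].
    by rewrite inE only_v => /andP[uK /eqP uv]; rewrite uv (negPf vK) in uK.
  - by rewrite /follows /= nx'v.
have [w [wx mem_w cnt_w fol_w]] := toursP x xP xK; exists w; split=> //.
- by move=> u; rewrite same_sets.
- move=> e; rewrite cnt_w; suff -> : [set u in K | (u \in rcons P v) && (rt u == x)] =
      [set u in K | (u \in P) && (rt u == x)] by [].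
  by apply/setP=> u; rewrite !inE same_sets.
- rewrite /follows -fol_w; apply/eq_in_map => u; rewrite mem_skip_repeated mem_w.
  by case/andP=> uP _; apply: nx'E; apply: contraNneq vP => <-.
Qed.

Lemma tours_insert P v Q nx nx' : o = P ++ v :: Q -> v \in K ->
    nx' (par v) = v -> nx' v = nx (par v) ->
    (forall u, u != v -> u != par v -> nx' u = nx u) ->
  tours P nx -> tours (rcons P v) nx'.
Proof.
move=> oE vK nx'a nx'v nx'E toursP x; have vP := fresh oE.
set a := par v in nx'a nx'v nx'E.
have Pn0 : P != [::] by rewrite (root_first oE) K_neq_root.
have aP : a \in P := par_before oE Pn0.
rewrite mem_rcons inE; case: eqVneq => [-> _|xv /= xP xK]; first by rewrite vK.
have [w [[wx lwx] mem_w cnt_w fol_w]] := toursP x xP xK.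
have vw : v \notin w by rewrite mem_w (negPf vP).
(* If [v] lies in another kept tree, so does its parent, and no pointer on the walk of [x]
   changes. *)
case: (eqVneq (rt v) x) => [vx|vx]; last first.
  have same_sets u : (u \in rcons P v) && (rt u == x) = (u \in P) && (rt u == x).
    by rewrite mem_rcons inE; case: eqP => //= ->; rewrite (negPf vx) andbF.
  exists w; split=> //.
  - by move=> u; rewrite same_sets.
  - move=> e; rewrite cnt_w; suff -> : [set u in K | (u \in rcons P v) && (rt u == x)] =
      [set u in K | (u \in P) && (rt u == x)] by [].
    by apply/setP=> u; rewrite !inE same_sets.
  rewrite /follows -fol_w; apply/eq_in_map => u; rewrite mem_skip_repeated => uw.
  apply: nx'E; first by apply: contraNneq vw => <-.
  apply: contraNneq vx => ua; move: uw; rewrite mem_w ua => /andP[_].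
  by rewrite /a rt_par.
have aw : a \in w by rewrite mem_w aP /a rt_par // vx eqxx.
(* The detour starts at the first occurrence of [a], the one that [skip_repeated] keeps. *)
have [w1 [w2 [wE aw1]]] : exists w1 w2 : seq V, w = w1 ++ a :: w2 /\ a \notin w1.
  exists (take (index a w) w), (drop (index a w).+1 w); split.
    by rewrite -[LHS](cat_take_drop (index a w)) (drop_nth x) ?index_mem // nth_index.
  by rewrite in_take_leq ?index_size // ltnn.
have mem_new u : (u \in w1 ++ [:: a, v, a & w2]) = (u == v) || (u \in w).
  by rewrite wE !mem_cat !inE; do !case: (_ == _); rewrite ?orbT.
have setE : [set u in K | (u \in rcons P v) && (rt u == x)] =
    v |: [set u in K | (u \in P) && (rt u == x)].
  apply/setP=> u; rewrite !inE mem_rcons inE; case: eqP => //= ->.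
  by rewrite vK vx eqxx.
exists (w1 ++ [:: a, v, a & w2]); split.
- move: wx lwx; rewrite wE; case: (w1) => [|y s] //=.
  by move=> -> ; rewrite !last_cat /= => h; split.
- move=> u; rewrite mem_new mem_w mem_rcons inE.
  by case: eqP => //= ->; rewrite vx eqxx.
(* The edge from [v] to its parent is new, since the earlier ones have both ends in [P]. *)
- move=> e; have tev : te v \notin te @: [set u in K | (u \in P) && (rt u == x)].
    apply/imsetP=> -[u]; rewrite inE => /and3P[uK uP _] /eqP.
    rewrite uv_eq => /orP[] /andP[/eqP vE _]; first by rewrite -vE (negPf vP) in uP.
    by have := par_prefix oE uP (K_neq_root uK); rewrite -vE (negPf vP).
  rewrite setE imsetU1 in_setU1 path_edges_cat.
  have -> : path_edges [:: a, v, a & w2] = [:: te v, te v & path_edges (a :: w2)].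
    by rewrite /= /te [uv a v]uvC.
  move: (cnt_w e); rewrite {1}wE path_edges_cat !count_cat /=.
  rewrite [te v == e]eq_sym; case: (eqVneq e (te v)) => [->|ev] //=.
  by rewrite (negPf tev) /= => E; rewrite addnCA (addnCA (count_mem _ _)) E.
have [A [B [sE s'E]]] : exists A B : seq V, skip_repeated (w1 ++ a :: w2) = A ++ a :: B /\
    skip_repeated (w1 ++ [:: a, v, a & w2]) = A ++ [:: a, v & B].
  by apply: skip_repeated_insert; rewrite // -wE.
rewrite s'E; apply: (follows_insert (nx := nx)) => //; first by rewrite -sE -wE.
move=> u uAB; have us : u \in skip_repeated w.
  by rewrite wE sE; move: uAB; rewrite !mem_cat inE => /orP[]->; rewrite ?orbT.
apply: nx'E; first by apply: contraNneq vw => <-; rewrite -mem_skip_repeated.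
have := uniq_skip_repeated w; rewrite wE sE uniq_catC /= => /andP[+ _].
by rewrite mem_cat orbC -mem_cat; apply: contraNneq => <-.
Qed.

Lemma follows_walk_edges nx q : follows nx q ->
  walk_edges q = [seq uv v (nx v) | v <- q].
Proof.
by move=> fol; rewrite /walk_edges -fol; elim: q {fol} => //= v q ->.
Qed.

Lemma tours_component nx x : tours o nx -> x \notin K -> exists q,
  [/\ uniq q, q =i rclass x, follows nx q
    & component_tour F (rclass x) (walk_mgraph q)].
Proof.
move=> toursP xK; have [w [[wx lwx] mem_w cnt_w fol_w]] := toursP x (mem_o x) xK.
have skipE : skip_repeated w =i rclass x.
  by move=> u; rewrite mem_skip_repeated mem_w mem_o inE.
exists (skip_repeated w); split=> //; first exact: uniq_skip_repeated.
have xS : x \in rclass x by rewrite inE rt_root.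
have fcE : forest_comp F (rclass x) = te @: [set v in K | (v \in o) && (rt v == x)].
  apply/setP=> e; rewrite inE; apply/andP/imsetP => [[/imsetP[v vK ->]]|[v]].
    move/subsetP/(_ v); rewrite in_uv eqxx => /(_ isT); rewrite inE => vx.
    by exists v; rewrite // inE vK mem_o.
  rewrite inE mem_o /= => /andP[vK vx] ->; rewrite imset_f //; split=> //.
  by apply/subsetP=> u; rewrite in_uv inE => /orP[]/eqP->; rewrite ?rt_par.
rewrite /component_tour; case: ltnP => [S2|S1]; last first.
  have SE : rclass x = [set x].
    by apply/esym/eqP; rewrite eqEcard sub1set xS cards1.
  exists x => //; have -> : skip_repeated w = [:: x].
    apply: perm_small_eq => //; apply: uniq_perm; rewrite ?uniq_skip_repeated //.
    by move=> u; rewrite skipE SE !inE.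
  by apply/ffunP=> e; rewrite !ffunE /= addn0 eq_sym.
(* The walk ends where it starts; without its last vertex it is a closed walk in the sense of
   [walk_mgraph], with the same first occurrences. *)
case: w wx lwx mem_w cnt_w {fol_w} skipE => [|_ p] //= [->].
case/lastP: p => [_ _ _ skipE|p y].
  move: S2; suff -> : rclass x = [set x] by rewrite cards1.
  by apply/setP=> u; rewrite -skipE !inE.
rewrite last_rcons => -> mem_w cnt_w skipE; exists (x :: p); split.
  by move=> e; rewrite ffunE walk_edges_cons cnt_w fcE.
congr walk_mgraph; rewrite /skip_repeated -rcons_cons rev_rcons /=.
by rewrite mem_rev inE eqxx.
Qed.

(** The edges from each vertex to its successor, grouped by kept trees, make up all [H i]: a loop
    for a single vertex, two parallel edges for a pair. Agents are numbered by enumerating the roots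
    [~: K]. *)
Lemma tours_alg_run nx : agents I <= #|V| -> min_spanning_forest I F ->
    #|K| + agents I = #|V| -> tours o nx ->
  alg_run I (Some [ffun e => \sum_v (uv v (nx v) == e) +
                             \sum_(v | e == loop v) (req I v - 1)]).
Proof.
move=> mV minF cardK toursP.
have cardC : #|~: K| = agents I by move: cardK; rewrite -(cardsC K) => /addnI.
pose root (i : 'I_(agents I)) : V := enum_val (cast_ord (esym cardC) i).
have rootK i : root i \notin K by have := enum_valP (cast_ord (esym cardC) i); rewrite inE.
have root_inj : injective root.
  by move=> i j /enum_val_inj /cast_ord_inj.
have rootP x : x \notin K -> exists i, root i = x.
  move=> xK; have xC : x \in ~: K by rewrite inE.
  exists (cast_ord cardC (enum_rank_in xC x)).
  by rewrite /root cast_ordK enum_rankK_in.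
pose S i := rclass (root i).
have injS : injective S.
  by move=> i j /rclass_inj; rewrite !inE => /(_ (rootK i) (rootK j)) /root_inj.
have SF : [set S i | i : 'I_(agents I)] = comps F.
  rewrite comps_kept; apply/setP=> T; apply/imsetP/imsetP => [[i _ ->]|[x]].
    by exists (root i); rewrite ?inE.
  by rewrite inE => /rootP[i <-] ->; exists i.
have [q qP] := fin_all_exists (fun i => tours_component toursP (rootK i)).
have [pick pickP] := fin_all_exists (fun v => rootP (rt v) (rt_notin v)).
have -> : [ffun e => \sum_v (uv v (nx v) == e) + \sum_(v | e == loop v) (req I v - 1)] =
    [ffun e => \sum_i add_loops I (fun i => walk_mgraph (q i)) pick i e].
  rewrite sum_add_loops; apply/ffunP=> e; rewrite ffunE [RHS]ffunE; congr (_ + _).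
  rewrite -(sum_parts injS SF); apply: eq_bigr => i _; have [uq qS fol _] := qP i.
  rewrite ffunE (follows_walk_edges fol) count_map -sum1_count [RHS]big_mkcond.
  by rewrite [RHS]big_uniq //; apply: eq_bigl => v; rewrite qS.
apply: (run_yes (F := F) (S := S)) => //; first by move=> i; have [] := qP i.
move=> v; rewrite inE deg_walk double_gt0 -has_count has_pred1.
by have [_ -> _ _] := qP (pick v); rewrite inE pickP.
Qed.

End Tours.
End Prim.

(** * Programs and their running time *)

(** A constant weighs more than its value, so that every value is at most the size times [word]. *)
Fixpoint esize (x : expr) : nat :=
  match x with
  | Const k => k.+1
  | InN | InM => 1
  | Read _ i | InReq i => (esize i).+1
  | Add x y | Defs.Sub x y | Leq x y => (esize x + esize y).+1
  | CostLeq i j k l => (esize i + esize j + esize k + esize l).+1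
  end.

(** A round bound: the largest expression of the program, the multiplicity of a non-loop edge in
    [emit_tours], has size 35. *)
Definition max_esize := 40.

Lemma leq_bits a b : a <= b -> bits a <= bits b.
Proof. by move=> ab; rewrite ltnS leq_trunc_log. Qed.

Lemma bits_ltn a k : a < 2 ^ k -> bits a <= k.+1.
Proof.
case: (posnP a) => [->|a0 ak]; first by rewrite /bits trunc_log0.
rewrite ltnS; apply: ltnW; rewrite -(@ltn_exp2l 2) //.
exact: leq_ltn_trans (trunc_logP _ a0) ak.
Qed.

Lemma ltn_bits a : a < 2 ^ bits a.
Proof. exact: trunc_log_ltn. Qed.

Definition For (a : nat) (lo hi : expr) (body : cmd) : cmd :=
  Seq (Write a (Const 0) lo)
    (While (Leq (Add (Read a (Const 0)) (Const 1)) hi)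
       (Seq body (Write a (Const 0) (Add (Read a (Const 0)) (Const 1))))).

(** * A program logic with time bounds *)

Section Logic.
Variables (R : realFieldType) (V : finType) (I : instance R V).
Implicit Types (s : state) (x : expr) (c : cmd) (Q : state -> Prop).

Local Notation n := #|V|.
Local Notation mem := Defs.mem.

(** Bounds every memory cell throughout a run; values of expressions exceed it by at most a constant
    factor. *)
Definition word : nat := n + agents I + total_req I.

Lemma word_gt0 : 0 < word.
Proof. by rewrite /word addn_gt0 addn_gt0 agents_gt0 orbT. Qed.

Lemma card_word : n <= word.
Proof. by rewrite /word -addnA leq_addr. Qed.

Lemma req_word v : req I v <= word.
Proof.
rewrite /word; apply: leq_trans (leq_addl _ _).
by rewrite /total_req (bigD1 v) //= leq_addr.
Qed.

Definition bounded s := forall a i, mem s a i <= word.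

Lemma eval_bound s x : bounded s -> eval I s x <= esize x * word.
Proof.
move=> bs; have w0 := word_gt0.
have small k m : k <= word -> k <= m.+1 * word.
  by move=> kw; rewrite mulSn (leq_trans kw) ?leq_addr.
elim: x => [k|a x _|x IHx y IHy|x IHx y IHy|x IHx y IHy|||x _|i _ j _ k _ l _] /=.
- by rewrite (leq_trans (leqnSn k)) // leq_pmulr.
- exact: small.
- by rewrite mulSn mulnDl; apply: leq_trans (leq_addl _ _); apply: leq_add.
- rewrite (leq_trans (leq_subr _ _)) // (leq_trans IHx) // leq_mul2r.
  by rewrite orbC leqW ?leq_addr.
- by apply: small; apply: leq_trans (leq_b1 _) w0.
- by rewrite mul1n card_word.
- by rewrite mul1n /word addnAC leq_addl.
- by apply: small; case: vertex_at => // v; apply: req_word.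
- by apply: small; do 2!case: edge_at => [?|] //; apply: leq_trans (leq_b1 _) w0.
Qed.

Lemma etime_bound s x L : bounded s -> esize x * word <= L ->
  etime I s x <= esize x * bits L.
Proof.
move=> bs; elim: x =>
    [k|a x IHx|x IHx y IHy|x IHx y IHy|x IHx y IHy|||x IHx|i IHi j IHj k IHk l IHl];
  move=> xL; have {}xE := leq_bits (leq_trans (eval_bound _ bs) xL);
  move: xL xE; rewrite /etime -/etime [esize _]/= => xL xE.
- by rewrite addn0 mulSn (leq_trans xE) ?leq_addr.
- by rewrite mulSn leq_add // IHx // (leq_trans _ xL) // leq_mul2r leqnSn orbT.
- rewrite mulSn mulnDl leq_add // leq_add // ?IHx ?IHy //;
  by rewrite (leq_trans _ xL) // leq_mul2r leqW ?orbT ?leq_addr ?leq_addl.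
- rewrite mulSn mulnDl leq_add // leq_add // ?IHx ?IHy //;
  by rewrite (leq_trans _ xL) // leq_mul2r leqW ?orbT ?leq_addr ?leq_addl.
- rewrite mulSn mulnDl leq_add // leq_add // ?IHx ?IHy //;
  by rewrite (leq_trans _ xL) // leq_mul2r leqW ?orbT ?leq_addr ?leq_addl.
- by rewrite addn0 mul1n.
- by rewrite addn0 mul1n.
- by rewrite mulSn leq_add // IHx // (leq_trans _ xL) // leq_mul2r leqnSn orbT.
rewrite mulSn !mulnDl leq_add //; move: xL; rewrite mulSn !mulnDl => xL.
by do ![apply: leq_add]; rewrite ?IHi ?IHj ?IHk ?IHl //; lia.
Qed.

Definition unit_time := max_esize * bits (max_esize * word).

Lemma etime_unit s x : bounded s -> esize x <= max_esize -> etime I s x <= unit_time.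
Proof.
move=> bs sx; have xL : esize x * word <= max_esize * word by rewrite leq_mul2r sx orbT.
by apply: leq_trans (etime_bound bs xL) _; rewrite leq_mul2r sx orbT.
Qed.

(* A loop is charged #|V| iterations: the programs below have only For loops
   with upper bound at most #|V|. *)
Fixpoint steps c : nat :=
  match c with
  | Skip | AnswerNo => 1
  | Write _ _ _ => 2
  | Emit _ _ _ => 3
  | Seq p q => steps p + steps q
  | If _ p q => (steps p + steps q).+1
  | While _ p => (n.+1 * (steps p).+1).+1
  end.

(** Total correctness with the time bound built in, so that invariants speak of memory and output
    only. *)
Definition wp c Q s : Prop := bounded s -> exists s' t,
  [/\ exec I c s s' t, bounded s', Q s' & t <= steps c * unit_time].

Lemma wp_Skip Q s : Q s -> wp Skip Q s.
Proof. by move=> q b; exists s, 1; split=> //; constructor. Qed.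

Lemma wp_AnswerNo Q s : Q (answer_no s) -> wp AnswerNo Q s.
Proof. by move=> q b; exists (answer_no s), 1; split=> //; constructor. Qed.

Lemma wp_Write a i x Q s : esize i <= max_esize -> esize x <= max_esize ->
    eval I s x <= word -> Q (store s a (eval I s i) (eval I s x)) ->
  wp (Write a i x) Q s.
Proof.
move=> si sx xw q b; eexists _, _; split; [exact: exec_Write | | exact: q |].
  by move=> a' j /=; case: ifP.
by rewrite mul2n -addnn leq_add // etime_unit.
Qed.

Lemma wp_Emit i j k Q s :
    esize i <= max_esize -> esize j <= max_esize -> esize k <= max_esize ->
    Q (emit s (eval I s i, eval I s j, eval I s k)) ->
  wp (Emit i j k) Q s.
Proof.
move=> si sj sk q b; eexists _, _; split; [exact: exec_Emit | by [] | exact: q |].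
by rewrite !mulSn mul0n addn0 addnA !leq_add // etime_unit.
Qed.

Lemma wp_Seq p q Q s : wp p (wp q Q) s -> wp (Seq p q) Q s.
Proof.
move=> hp b; have [s1 [t1 [e1 b1 hq l1]]] := hp b.
have [s2 [t2 [e2 b2 hQ l2]]] := hq b1; exists s2, (t1 + t2); split=> //.
  exact: exec_Seq e1 e2.
by rewrite mulnDl leq_add.
Qed.

Lemma wp_If x p q Q s : esize x <= max_esize ->
    (eval I s x != 0 -> wp p Q s) -> (eval I s x = 0 -> wp q Q s) ->
  wp (If x p q) Q s.
Proof.
move=> sx hp hq b; case: (eqVneq (eval I s x) 0) => [x0|x0].
  have [s1 [t1 [e1 b1 hQ l1]]] := hq x0 b.
  exists s1, (etime I s x + t1); split=> //; first exact: exec_IfFalse.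
  rewrite mulSn mulnDl leq_add ?etime_unit //; exact: leq_trans l1 (leq_addl _ _).
have [s1 [t1 [e1 b1 hQ l1]]] := hp x0 b.
exists s1, (etime I s x + t1); split=> //; first exact: exec_IfTrue.
rewrite mulSn mulnDl leq_add ?etime_unit //; exact: leq_trans l1 (leq_addr _ _).
Qed.

(** [J k] holds when the counter is [k], and the body must hand the counter back unchanged. The
    bound 30 on [hi] leaves room for the guard, which is larger by 6. *)
Lemma wp_For a lo hi l h body (J : nat -> state -> Prop) Q s :
    esize lo <= max_esize -> esize hi <= 30 ->
    eval I s lo = l -> (forall s', eval I s' hi = h) -> l <= h <= n ->
    J l (store s a 0 l) ->
    (forall k s', l <= k < h -> mem s' a 0 = k -> J k s' ->
       wp body (fun s'' => mem s'' a 0 = k /\ J k.+1 (store s'' a 0 k.+1)) s') ->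
    (forall s', mem s' a 0 = h -> J h s' -> Q s') ->
  wp (For a lo hi body) Q s.
Proof.
move=> slo shi lol hiE /andP[lh hn] Jl Jbody JQ; have hw := leq_trans hn card_word.
apply: wp_Seq; apply: wp_Write => //; first by rewrite lol (leq_trans lh).
rewrite lol /=; set s0 := store s a 0 l in Jl *.
have s0l : mem s0 a 0 = l by rewrite /= !eqxx.
move: s0 Jl s0l => s0 Js s0l; set step := Seq body _; set loop := While _ _.
suff: forall d k s, l <= k -> k + d = h -> J k s -> mem s a 0 = k -> bounded s ->
    exists s' t, [/\ exec I loop s s' t, bounded s', Q s'
      & t <= (d * (steps step).+1).+1 * unit_time].
  move=> H bs; have [s' [t [e b q ht]]] := H (h - l) l s0 (leqnn l) (subnKC lh) Js s0l bs.
  exists s', t; split=> //; apply: leq_trans ht _; rewrite leq_mul2r; apply/orP; right.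
  rewrite -[steps loop]/(n.+1 * (steps step).+1).+1 ltnS leq_mul2r; apply/orP; right.
  by apply: leq_trans (leq_subr _ _) _; apply: leqW.
elim=> [|d IH] k s1 lk kd Jk s1k b1.
  have x0 : eval I s1 (Leq (Add (Read a (Const 0)) (Const 1)) hi) = 0.
    by rewrite /= s1k hiE; lia.
  exists s1, (etime I s1 (Leq (Add (Read a (Const 0)) (Const 1)) hi)); split=> //.
  - exact: exec_WhileFalse.
  - by apply: JQ; rewrite // -kd addn0.
  - rewrite mul1n etime_unit //=; move: shi; rewrite /max_esize; lia.
have x0 : eval I s1 (Leq (Add (Read a (Const 0)) (Const 1)) hi) != 0.
  by rewrite /= s1k hiE; lia.
have [|s2 [t2 [e2 b2 [s2k J2] l2]]] := Jbody k s1 _ s1k Jk b1; first by lia.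
set s3 := store s2 a 0 k.+1 in J2.
have b3 : bounded s3 by move=> a' j /=; case: ifP => // _; lia.
have s3k : mem s3 a 0 = k.+1 by rewrite /= !eqxx.
have [||s4 [t4 [e4 b4 q4 l4]]] := IH k.+1 s3 _ _ J2 s3k b3; [lia | lia |].
have e3 : exec I (Write a (Const 0) (Add (Read a (Const 0)) (Const 1))) s2 s3
    (etime I s2 (Const 0) + etime I s2 (Add (Read a (Const 0)) (Const 1))).
  have := exec_Write I s2 a (Const 0) (Add (Read a (Const 0)) (Const 1)).
  by rewrite /= s2k addn1.
have eW := exec_WhileTrue x0 (exec_Seq e2 e3) e4.
exists s4; eexists; split; [exact: eW | exact: b4 | exact: q4 |].
have := @etime_unit s2 (Const 0) b2 isT.
have := @etime_unit s2 (Add (Read a (Const 0)) (Const 1)) b2 isT.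
have : etime I s1 (Leq (Add (Read a (Const 0)) (Const 1)) hi) <= unit_time.
  by rewrite etime_unit //=; move: shi; rewrite /max_esize; lia.
move: l2 l4; rewrite [steps step]/=.
move: (etime _ _ _) (etime _ _ _) (etime _ _ _) (unit_time) => y1 y2 y3 W; nia.
Qed.

End Logic.

(** Both coefficient and exponent in [steps_poly]. A loop adds 2: one factor for its rounds, one to
    absorb additive overhead. *)
Fixpoint csize (c : cmd) : nat :=
  match c with
  | Skip | AnswerNo => 1
  | Write _ _ _ => 2
  | Emit _ _ _ => 3
  | Seq p q => csize p + csize q
  | If _ p q => (csize p + csize q).+1
  | While _ p => (csize p).+2
  end.

Lemma steps_poly (V : finType) c : steps V c <= csize c * #|V|.+2 ^ csize c.
Proof.
have mono a b : a <= b -> #|V|.+2 ^ a <= #|V|.+2 ^ b by move=> ab; rewrite leq_pexp2l.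
have pos a : 0 < #|V|.+2 ^ a by rewrite expn_gt0.
elim: c => [|a i x|p IHp q IHq|x p IHp q IHq|x p IHp|i j k|]; rewrite /= ?leq_pmulr //.
- by rewrite mulnDl leq_add // (leq_trans IHp, leq_trans IHq) //
    leq_mul2l mono ?orbT ?leq_addr ?leq_addl.
- rewrite mulSn -add1n leq_add // mulnDl leq_add //.
    by rewrite (leq_trans IHp) // leq_mul2l mono ?orbT // leqW ?leq_addr.
  by rewrite (leq_trans IHq) // leq_mul2l mono ?orbT // leqW ?leq_addl.
suff le_loop N y st a : 1 < N -> 0 < y -> st <= a * y ->
    N.-1 * st.+1 < a.+2 * (N * (N * y)).
  by rewrite 2!expnS; apply: (le_loop #|V|.+2).
move=> N1 y0 leS; have leS' : st.+1 <= a.+1 * y by nia.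
apply: (@leq_trans (N * (a.+1 * y))); last by nia.
apply: (@leq_trans (N * st.+1)); first by nia.
by rewrite leq_mul2l leS' orbT.
Qed.

Lemma poly_time (c : cmd) : exists k, forall (R : realFieldType) (V : finType) (I : instance R V),
  steps V c * unit_time I <= k * (#|V| + agents I + trunc_log 2 (total_req I)) ^ k.
Proof.
move: (csize c) (@steps_poly ^~ c) => a stepsP; move Dm: max_esize => D.
(* The factor [a * 3 ^ a] comes from [steps], as n + 2 <= 3 N, and [D * (D + 4)] from [unit_time];
   [a.+1] is the exponent. The sum dominates both coefficient and exponent. *)
exists (a * 3 ^ a * (D * (D + 4)) + a.+1) => R V I.
set N := #|V| + agents I + _; have N0 : 0 < N by rewrite addn_gt0 addn_gt0 agents_gt0 orbT.
(* Only r(V) must enter through its logarithm; for n and m the crude bounds n < 2 ^ n and m < 2 ^ m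
   suffice. *)
have bitsN : bits (D * word I) <= (D + 4) * N.
  apply: (@leq_trans (D + #|V| + agents I + (trunc_log 2 (total_req I)).+1 + 1).+1); last first.
    by have := leq_pmulr D N0; rewrite mulnDl {2}/N; lia.
  apply: bits_ltn; rewrite addn1 expnS !expnD.
  have h1 := ltn_expl D (isT : 1 < 2); have h2 := ltn_expl #|V| (isT : 1 < 2).
  have h3 := ltn_expl (agents I) (isT : 1 < 2); have h4 := ltn_bits (total_req I).
  rewrite /bits in h4; rewrite /word.
  move: (2 ^ D) (2 ^ #|V|) (2 ^ agents I) (2 ^ (trunc_log 2 (total_req I)).+1)
    h1 h2 h3 h4 (agents_gt0 I) => x y z w.
  move: #|V| (agents I) (total_req I) => n m r h1 h2 h3 h4 m0.
  have le1 : n.+1 * m.+1 * r.+1 <= y * z * w by rewrite !leq_mul.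
  have le2 : n + m + r <= y * z * w by nia.
  apply: (@leq_ltn_trans (D * (y * z * w))); first by rewrite leq_mul2l le2 orbT.
  have p0 : 0 < y * z * w by nia.
  have -> : 2 * (x * y * z * w) = (2 * x) * (y * z * w) by ring.
  by rewrite ltn_pmul2r //; lia.
have stepsN : steps V c <= a * 3 ^ a * N ^ a.
  apply: leq_trans (stepsP V) _; rewrite -mulnA -expnMn leq_mul2l.
  by case: (a) => // a'; rewrite leq_exp2r // orbC; lia.
rewrite /unit_time Dm; set k := _ + a.+1.
apply: (@leq_trans ((a * 3 ^ a * N ^ a) * (D * ((D + 4) * N)))).
  by rewrite leq_mul // leq_mul2l bitsN orbT.
apply: (@leq_trans (k * N ^ a.+1)); last by rewrite leq_mul2l leq_pexp2l ?orbT // leq_addl.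
have -> : a * 3 ^ a * N ^ a * (D * ((D + 4) * N)) = a * 3 ^ a * (D * (D + 4)) * N ^ a.+1.
  by rewrite expnS; ring.
by rewrite leq_mul2r leq_addr orbT.
Qed.

(** * The program *)

Definition var (a : nat) : expr := Read a (Const 0).
Definition set_var (a : nat) (x : expr) : cmd := Write a (Const 0) x.

(* Arrays: 0 outer loop counter, 1 inner loop counter, 2 result of scan,
   3 marks of the vertices in Prim's tree, 4 parent (for a vertex outside the
   tree, its cheapest neighbour in it), 5 order of insertion, 6 marks of the
   kept vertices (and of the root), 7 successor. *)

(* The initial value #|V| is no vertex, so it loses every comparison of costs. *)
Definition scan (a : nat) : cmd :=
  Seq (set_var 2 InN)
    (For 1 (Const 0) InN
      (If (Read a (var 1)) Skip
        (If (CostLeq (var 2) (Read 4 (var 2)) (var 1) (Read 4 (var 1))) Skip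
          (set_var 2 (var 1))))).

Definition relax : cmd :=
  For 1 (Const 0) InN
    (If (Read 3 (var 1)) Skip
      (If (CostLeq (var 1) (Read 4 (var 1)) (var 1) (var 2)) Skip
        (Write 4 (var 1) (var 2)))).

(** Zeroed memory already makes vertex 0 the first of the order and the parent of all others, so
    only its mark has to be set. *)
Definition prim : cmd :=
  Seq (Write 3 (Const 0) (Const 1))
    (For 0 (Const 1) InN
      (Seq (scan 3) (Seq (Write 3 (var 2) (Const 1))
        (Seq (Write 5 (var 0) (var 2)) relax)))).

(** The root is marked beforehand because it has no tree edge to select. *)
Definition select : cmd :=
  Seq (Write 6 (Const 0) (Const 1))
    (For 0 (Const 0) (Defs.Sub InN InM)
      (Seq (scan 6) (Write 6 (var 2) (Const 1)))).

(** Vertex 0 is its own successor in zeroed memory, so the count starts at 1. A kept vertex copies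
    its parent's successor before the parent is redirected. *)
Definition link : cmd :=
  For 0 (Const 1) InN
    (If (Read 6 (Read 5 (var 0)))
      (Seq (Write 7 (Read 5 (var 0)) (Read 7 (Read 4 (Read 5 (var 0)))))
           (Write 7 (Read 4 (Read 5 (var 0))) (Read 5 (var 0))))
      (Write 7 (Read 5 (var 0)) (Read 5 (var 0)))).

Definition Eq (x y : expr) : expr := Leq (Const 2) (Add (Leq x y) (Leq y x)).

(** Only pairs i <= j are listed, so each edge appears once. Off the diagonal both directions count,
    which yields the two parallel edges of a two-vertex cycle. *)
Definition emit_tours : cmd :=
  For 0 (Const 0) InN
    (Seq (Emit (var 0) (var 0)
           (Add (Eq (Read 7 (var 0)) (var 0)) (Defs.Sub (InReq (var 0)) (Const 1))))
      (For 1 (Const 0) InN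
        (If (Leq (Add (var 0) (Const 1)) (var 1))
          (Emit (var 0) (var 1)
            (Add (Eq (Read 7 (var 0)) (var 1)) (Eq (Read 7 (var 1)) (var 0))))
          Skip))).

Definition program : cmd :=
  If (Leq InM InN) (Seq prim (Seq select (Seq link emit_tours))) AnswerNo.

(** * Correctness of scanning and of Prim's phase *)

Section Program.
Variables (R : realFieldType) (V : finType) (I : instance R V) (v0 : V).
Implicit Types (s : state).

Local Notation n := #|V|.
Local Notation mem := Defs.mem.
Local Notation word := (word I).

Definition vx (i : nat) : V := nth v0 (enum V) i.
Definition rank (v : V) : nat := index v (enum V).
Definition cst (i j : nat) : R := cost I (uv (vx i) (vx j)).

Lemma rank_lt v : rank v < n.
Proof. by rewrite cardE index_mem mem_enum. Qed.

Lemma vxK i : i < n -> rank (vx i) = i.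
Proof. by move=> lin; rewrite /rank /vx index_uniq ?enum_uniq // -cardE. Qed.

Lemma rankK v : vx (rank v) = v.
Proof. by rewrite /vx nth_index // mem_enum. Qed.

Lemma vx_eq i j : i < n -> j < n -> (vx i == vx j) = (i == j).
Proof.
move=> lin ljn; apply/eqP/eqP => [E|->//].
by rewrite -(vxK lin) E vxK.
Qed.

Lemma cstC i j : cst i j = cst j i.
Proof. by rewrite /cst uvC. Qed.

Lemma vertex_at_lt i : i < n -> vertex_at V i = Some (vx i).
Proof.
by move=> lin; rewrite /vertex_at onthE (nth_map v0) // -cardE.
Qed.

Lemma vertex_at_geq i : n <= i -> vertex_at V i = None.
Proof. by move=> lin; rewrite /vertex_at onthE nth_default // size_map -cardE. Qed.

Lemma edge_at_lt i j : i < n -> j < n -> edge_at V i j = Some (uv (vx i) (vx j)).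
Proof. by move=> li lj; rewrite /edge_at !vertex_at_lt. Qed.

Lemma edge_at_geq i j : n <= i -> edge_at V i j = None.
Proof. by move=> li; rewrite /edge_at vertex_at_geq. Qed.

Lemma mem_store_neq s a i x b : b != a -> mem (store s a i x) b = mem s b.
Proof. by move=> /negPf ba; rewrite /= ba. Qed.

Definition same s s' : Prop :=
  out s' = out s /\ forall b, b != 1 -> b != 2 -> mem s' b = mem s b.

Lemma wp_scan a Q s : a != 1 -> a != 2 -> (forall v, mem s 4 v < n) ->
    (exists2 v, v < n & mem s a v = 0) ->
    (forall s', same s s' -> mem s' 2 0 < n -> mem s a (mem s' 2 0) = 0 ->
       (forall v, v < n -> mem s a v = 0 ->
          (cst (mem s' 2 0) (mem s 4 (mem s' 2 0)) <= cst v (mem s 4 v))%R) ->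
       Q s') ->
  wp I (scan a) Q s.
Proof.
move=> a1 a2 par_lt [u un au] HQ.
pose best k b := (b = n /\ forall v, v < k -> mem s a v != 0) \/
  [/\ b < n, mem s a b = 0 & forall v, v < k -> mem s a v = 0 ->
          (cst b (mem s 4 b) <= cst v (mem s 4 v))%R].
apply: wp_Seq; apply: wp_Write => //; first exact: card_word.
set s1 := store _ _ _ _.
have same1 : same s s1.
  by split=> // b b1 b2; rewrite mem_store_neq.
apply: (@wp_For _ _ _ 1 _ _ 0 n _ (fun k s' => same s s' /\ best k (mem s' 2 0))) => //.
- exact: leqnn.
- split; last by left.
  by case: same1 => o1 m1; split=> // b b1 b2; rewrite mem_store_neq // m1.
- move=> k s2 kn s2k [[o2 m2] best2].
  have keep b : b = mem s2 2 0 -> best k.+1 b ->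
     mem s2 1 0 = k /\ same s (store s2 1 0 k.+1) /\ best k.+1 (mem (store s2 1 0 k.+1) 2 0).
    move=> -> bb; split=> //; split=> //; split=> // b' b1 b2.
    by rewrite mem_store_neq // m2.
  apply: wp_If => //= ak.
    apply: wp_Skip; apply: (keep _ erefl); move: ak; rewrite s2k m2 // => ak.
    case: best2 => [[bn bk]|[bn b0 bk]]; [left | right]; split=> // v;
      rewrite ltnS leq_eqVlt => /orP[/eqP->|]; auto.
    by move=> k0; rewrite k0 in ak.
  move: ak; rewrite s2k m2 // => ak.
  apply: wp_If => //=; rewrite s2k [mem s2 4]m2 // => cmp.
    apply: wp_Skip; apply: (keep _ erefl).
    case: best2 => [[bn bk]|[bn b0 bk]]; first by rewrite edge_at_geq ?bn ?leqnn in cmp.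
    right; split=> // v; rewrite ltnS leq_eqVlt => /orP[/eqP-> _|]; last by auto.
    by move: cmp; rewrite !edge_at_lt ?par_lt // eqb0 negbK.
  apply: wp_Write => //=; first by rewrite s2k (leq_trans (ltnW kn)) ?card_word.
  split=> //; split; first by split=> // b b1 b2; rewrite !mem_store_neq // m2.
  rewrite /= s2k; right; split=> // v; rewrite ltnS leq_eqVlt => /orP[/eqP-> //|vk v_0].
  case: best2 => [[bn bk]|[bn b0 bk]]; first by have := bk v vk; rewrite v_0.
  apply: le_trans (bk v vk v_0).
  move: cmp => /eqP; rewrite !edge_at_lt ?par_lt // eqb0 -ltNge; exact: ltW.
move=> s2 _ [same2 best2]; case: best2 => [[_ /(_ u un)]|[bn b0 bk]]; first by rewrite au.
exact: HQ.
Qed.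

Definition inserted (ord : nat -> nat) k : seq nat := mkseq ord k.

Lemma insertedS ord k : inserted ord k.+1 = rcons (inserted ord k) (ord k).
Proof. exact: mkseqS. Qed.

Lemma eq_inserted ord ord' k : (forall j, j < k -> ord' j = ord j) ->
  inserted ord' k = inserted ord k.
Proof. by move=> E; apply/eq_in_map => j; rewrite mem_iota add0n => /andP[_ /E]. Qed.

(** [prim_best] is the working invariant for vertices outside the tree; [prim_tree] records that
    each edge was cheapest across its cut when inserted, which minimality needs afterwards. *)
Record prim_inv k (inn par ord : nat -> nat) : Prop := PrimInv {
  prim_root : ord 0 = 0;
  prim_uniq : uniq (inserted ord k);
  prim_lt : forall v, v \in inserted ord k -> v < n;
  prim_inn : forall v, v < n -> (inn v == 0) = (v \notin inserted ord k);
  prim_par_lt : forall v, par v < n;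
  prim_best : forall v, v < n -> v \notin inserted ord k -> par v \in inserted ord k /\
    forall u, u \in inserted ord k -> (cst v (par v) <= cst v u)%R;
  prim_tree : forall j, 0 < j < k -> par (ord j) \in inserted ord j /\
    forall u w, u \in inserted ord j -> w < n -> w \notin inserted ord j ->
      (cst (ord j) (par (ord j)) <= cst u w)%R }.

Lemma prim_exists k inn par ord : prim_inv k inn par ord -> k < n ->
  exists2 v, v < n & inn v = 0.
Proof.
move=> inv kn; have : ~~ all [in inserted ord k] (iota 0 n).
  apply/negP=> /allP sub; have := uniq_leq_size (iota_uniq 0 n) sub.
  by rewrite size_iota size_mkseq leqNgt kn.
case/allPn=> v; rewrite mem_iota add0n => /andP[_ vn] vN.
by exists v => //; apply/eqP; rewrite (prim_inn inv).
Qed.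

Lemma prim_step k inn par ord b inn' par' ord' : 0 < k -> prim_inv k inn par ord ->
    b < n -> inn b = 0 ->
    (forall v, v < n -> inn v = 0 -> (cst b (par b) <= cst v (par v))%R) ->
    (forall v, inn' v = if v == b then 1 else inn v) ->
    (forall j, ord' j = if j == k then b else ord j) ->
    (forall v, par' v = if (v < n) && (inn' v == 0) && (cst v b < cst v (par v))%R
                        then b else par v) ->
  prim_inv k.+1 inn' par' ord'.
Proof.
move=> k0 inv bn b0 bmin inn'E ord'E par'E.
have prefE j : j <= k -> inserted ord' j = inserted ord j.
  move=> jk; apply: eq_inserted => i ij; rewrite ord'E; case: eqP => // ik; lia.
have prefS : inserted ord' k.+1 = rcons (inserted ord k) b.
  by rewrite insertedS prefE // ord'E eqxx.
have bP : b \notin inserted ord k by rewrite -(prim_inn inv) // b0.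
(* Relaxation touches only unmarked vertices, so parents inside the tree are final. *)
have par_tree v : v \in inserted ord' k.+1 -> par' v = par v.
  rewrite prefS mem_rcons inE par'E inn'E => /orP[->|vP] /=; first by rewrite andbF.
  case: (v == b) => /=; first by rewrite andbF.
  by rewrite (prim_inn inv) ?(prim_lt inv) // vP andbF.
split.
- by rewrite ord'E ltn_eqF // (prim_root inv).
- by rewrite prefS rcons_uniq bP (prim_uniq inv).
- by move=> v; rewrite prefS mem_rcons inE => /orP[/eqP->//|]; apply: prim_lt inv _.
- move=> v vn; rewrite prefS mem_rcons inE inn'E; case: (v == b) => //=.
  by rewrite (prim_inn inv).
- by move=> v; rewrite par'E; case: ifP => // _; apply: prim_par_lt inv v.
- move=> v vn vP'; have := vP'; rewrite prefS mem_rcons inE negb_or => /andP[vb vP].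
  have [parP best] := prim_best inv vn vP; have v0' := prim_inn inv vn.
  rewrite par'E vn inn'E (negPf vb) v0' vP /=; case: ltP => cmp; split.
  + by rewrite mem_rcons inE eqxx.
  + move=> u; rewrite mem_rcons inE => /orP[/eqP->//|/best]; apply: le_trans; exact: ltW.
  + by rewrite mem_rcons inE parP orbT.
  + by move=> u; rewrite mem_rcons inE => /orP[/eqP->//|/best].
move=> j /andP[j0 jk]; have ordj : ord' j \in inserted ord' k.+1.
  by apply: map_f; rewrite mem_iota.
rewrite par_tree // prefE //; move: jk; rewrite ltnS leq_eqVlt => /orP[/eqP jk|jk].
  (* The chain is c(b, par b) <= c(w, par w) <= c(w, u): the scan gives the first step, [prim_best]
     the second. *)
  rewrite jk ord'E eqxx; have [parP best] := prim_best inv bn bP; split=> // u w uP wn wP.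
  have w0 : inn w = 0 by apply/eqP; rewrite (prim_inn inv).
  apply: le_trans (bmin w wn w0) _; rewrite [cst u w]cstC.
  by have [_] := prim_best inv wn wP; apply.
by rewrite ord'E (ltn_eqF jk); apply: prim_tree inv _ _; rewrite j0.
Qed.

Definition untouched (a : nat) s := forall i, mem s a i = 0.

Lemma wp_relax Q s : mem s 2 0 < n -> (forall v, mem s 4 v < n) ->
    (forall s', out s' = out s -> (forall b, b != 1 -> b != 4 -> mem s' b = mem s b) ->
      (forall v, mem s' 4 v =
         if (v < n) && (mem s 3 v == 0) && (cst v (mem s 2 0) < cst v (mem s 4 v))%R
         then mem s 2 0 else mem s 4 v) ->
      Q s') ->
  wp I relax Q s.
Proof.
move=> bn par_lt HQ; set b := mem s 2 0 in bn HQ *.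
pose J k s' := [/\ out s' = out s, forall a, a != 1 -> a != 4 -> mem s' a = mem s a &
  forall v, mem s' 4 v = if (v < k) && (mem s 3 v == 0) && (cst v b < cst v (mem s 4 v))%R
         then b else mem s 4 v].
apply: (@wp_For _ _ _ 1 _ _ 0 n _ J) => //.
- exact: leqnn.
- by split=> // a a1 _; rewrite mem_store_neq.
- move=> k s1 /= kn s1k [o1 m1 par1].
  have keep s2 : out s2 = out s1 -> mem s2 1 0 = k ->
      (forall a, a != 1 -> a != 4 -> mem s2 a = mem s a) ->
      (forall v, mem s2 4 v = if v == k then
         (if (mem s 3 v == 0) && (cst v b < cst v (mem s 4 v))%R then b else mem s 4 v)
         else mem s1 4 v) ->
      mem s2 1 0 = k /\ J k.+1 (store s2 1 0 k.+1).
    move=> o2 s2k m2 par2; split=> //; split; first by rewrite -o1.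
      by move=> a a1 a4; rewrite mem_store_neq ?m2.
    move=> v; rewrite mem_store_neq // par2 par1 [v < k.+1]ltnS [v <= k]leq_eqVlt.
    by case: eqP.
  have par1k : mem s1 4 k = mem s 4 k by rewrite par1 ltnn.
  apply: wp_If => //=; rewrite s1k [mem s1 3]m1 // => ink.
    apply: wp_Skip; apply: keep => // v; case: eqP => // ->.
    by rewrite (negPf ink) par1k.
  apply: wp_If => //=; rewrite s1k [mem s1 2]m1 // -/b par1k !edge_at_lt ?par_lt // => cmp.
    apply: wp_Skip; apply: keep => // v; case: eqP => // ->.
    by rewrite ltNge; move: cmp; rewrite eqb0 negbK => ->; rewrite andbF.
  move: cmp => /eqP; rewrite eqb0 -ltNge => cmp.
  apply: wp_Write => //=; first by rewrite m1 // (leq_trans (ltnW bn)) ?card_word.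
  apply: (keep (store s1 4 (mem s1 1 0) (mem s1 2 0))) => //=.
    by move=> a a1 a4; rewrite (negPf a4) /= m1.
  move=> v; rewrite s1k; case: eqP => // ->; rewrite ink eqxx /=.
  by rewrite [X in if X then _ else _]cmp m1.
move=> s1 _ [o1 m1 par1]; exact: HQ.
Qed.

Lemma wp_prim Q s : 0 < n -> (forall a, untouched a s) ->
    (forall s', prim_inv n (mem s' 3) (mem s' 4) (mem s' 5) -> out s' = out s ->
       untouched 6 s' -> untouched 7 s' -> Q s') ->
  wp I prim Q s.
Proof.
move=> n0 s0 HQ; have w0 := word_gt0 I.
apply: wp_Seq; apply: wp_Write => //=.
set s1 := store _ _ _ _.
pose J k s' := [/\ prim_inv k (mem s' 3) (mem s' 4) (mem s' 5), out s' = out s,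
  untouched 6 s' & untouched 7 s'].
apply: (@wp_For _ _ _ 0 _ _ 1 n _ J) => //.
- by rewrite n0 leqnn.
- have pre1 : inserted (mem s 5) 1 = [:: 0] by rewrite /inserted /mkseq /= s0.
  split; [ | by [] | by move=> i; apply: s0 | by move=> i; apply: s0].
  split; rewrite /= ?pre1 //.
  + exact: s0.
  + by move=> v; rewrite inE => /eqP->.
  + by move=> v vn; rewrite inE; case: (v == 0); rewrite ?s0.
  + by move=> v; rewrite s0.
  + move=> v vn; rewrite inE => vz; rewrite s0; split=> // u.
    by rewrite inE => /eqP->.
  + by move=> j; lia.
- move=> k s2 /andP[k0 kn] s2k [inv o2 z6 z7].
  apply: wp_Seq; apply: wp_scan => //; first exact: prim_par_lt inv.
    exact: prim_exists inv kn.
  move=> s3 [o3 m3] bn b0 bmin; set b := mem s3 2 0 in bn b0 bmin.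
  apply: wp_Seq; apply: wp_Write => //=.
  apply: wp_Seq; apply: wp_Write => //=; first by rewrite (leq_trans (ltnW bn)) ?card_word.
  apply: wp_relax => //=; first by move=> v; rewrite m3 //; apply: prim_par_lt inv v.
  move=> s4 o4 m4 par4; split; first by rewrite m4 //= m3.
  split=> /=; last 3 first.
  + by rewrite o4 o3.
  + by move=> i; rewrite /= m4 //= m3.
  + by move=> i; rewrite /= m4 //= m3.
  apply: (@prim_step k (mem s2 3) (mem s2 4) (mem s2 5) b) => //.
  + by move=> v; rewrite m4 //= -/b m3.
  + by move=> v; rewrite m4 //= [mem s3 0]m3 // s2k -/b m3.
  + by move=> v; rewrite par4 [mem s4 3]m4 //= -/b [mem s3 4]m3.
move=> s2 _ [inv o2 z6 z7]; exact: HQ.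
Qed.

End Program.

(** * Selecting the cheapest tree edges *)

Section Program2.
Variables (R : realFieldType) (V : finType) (I : instance R V) (v0 : V).
Implicit Types (s : state).

Local Notation n := #|V|.
Local Notation mem := Defs.mem.
Local Notation word := (word I).
Local Notation vx := (vx v0).
Local Notation cst := (cst I v0).

Record keep_inv (par keep : nat -> nat) (ks : seq nat) : Prop := KeepInv {
  keep_uniq : uniq ks;
  keep_lt : forall v, v \in ks -> 0 < v < n;
  keep_mem : forall v, v < n -> (keep v == 0) = (v \notin 0 :: ks);
  keep_min : forall v w, v \in ks -> w < n -> keep w = 0 ->
    (cst v (par v) <= cst w (par w))%R }.

Lemma exists_notin (l : seq nat) : size l < n -> exists2 v, v < n & v \notin l.
Proof.
move=> sl; have : ~~ all [in l] (iota 0 n).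
  apply/negP=> /allP sub; have := uniq_leq_size (iota_uniq 0 n) sub.
  by rewrite size_iota leqNgt sl.
by case/allPn=> v; rewrite mem_iota add0n => /andP[_ vn] vN; exists v.
Qed.

Lemma wp_select Q s : agents I <= n -> (forall v, mem s 4 v < n) -> untouched 6 s ->
    (forall s' ks, out s' = out s -> mem s' 4 = mem s 4 -> mem s' 5 = mem s 5 ->
       mem s' 7 = mem s 7 -> keep_inv (mem s 4) (mem s' 6) ks ->
       size ks = n - agents I -> Q s') ->
  wp I select Q s.
Proof.
move=> mn par_lt s0 HQ; have w0 := word_gt0 I; have m0 := agents_gt0 I.
apply: wp_Seq; apply: wp_Write => //=.
set s1 := store _ _ _ _.
pose J k s' := [/\ out s' = out s,
  [/\ mem s' 4 = mem s 4, mem s' 5 = mem s 5 & mem s' 7 = mem s 7]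
  & exists2 ks, keep_inv (mem s 4) (mem s' 6) ks & size ks = k].
apply: (@wp_For _ _ _ 0 _ _ 0 (n - agents I) _ J) => //.
- exact: leq_subr.
- split=> //; exists [::] => //; split=> // v vn /=.
  by rewrite inE; case: (v == 0); rewrite ?s0.
- move=> k s2 /= kn s2k [o2 [p2 q2 t2] [ks inv sks]].
  apply: wp_Seq; apply: wp_scan => //; first by rewrite p2.
    (* Fewer than n - m vertices are selected so far and m >= 1, so even with the root some vertex
       is unmarked. *)
    have [|v vn vN] := @exists_notin (0 :: ks); first by rewrite /= sks; lia.
    by exists v => //; apply/eqP; rewrite (keep_mem inv).
  move=> s3 [o3 m3]; rewrite p2; set b := mem s3 2 0 => bn b0 bmin.
  apply: wp_Write => //=; split; first by rewrite m3.
  split=> /=; [by rewrite o3 | by rewrite !m3 |].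
  have bN : b \notin 0 :: ks by rewrite -(keep_mem inv) // b0.
  move: (bN); rewrite inE negb_or => /andP[bpos bks].
  exists (b :: ks); last by rewrite /= sks.
  split=> [|v|v vn|v w]; first by rewrite /= bks (keep_uniq inv).
  + by rewrite inE => /orP[/eqP->|/(keep_lt inv)//]; rewrite lt0n bpos.
  + rewrite -/b m3 // !inE; case: (v == b) => /=; first by rewrite orbT.
    by rewrite (keep_mem inv) // inE.
  rewrite -/b m3 // inE; case: (w == b) => // vP wn w_0.
  by case/orP: vP => [/eqP->|vks]; [apply: bmin | apply: keep_min inv _ _ _ _ _].
by move=> s2 _ [o2 [p2 q2 t2] [ks inv sks]]; apply: HQ inv sks.
Qed.

(** * From the arrays to the abstract tree and its tours *)

Section Final.
Variables (inn par ord keep : nat -> nat) (ks : seq nat).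
Hypothesis mn : agents I <= n.
Hypothesis inv : prim_inv I v0 n inn par ord.
Hypothesis kinv : keep_inv par keep ks.

Let n0 : 0 < n. Proof. exact: leq_trans (agents_gt0 I) mn. Qed.

Definition orderV : seq V := map vx (inserted ord n).
Definition parV (v : V) : V := vx (par (rank v)).
(** The root is marked in the array too, hence the second condition. *)
Definition keptV : {set V} := [set v | (keep (rank v) != 0) && (rank v != 0)].

Lemma ord_lt k : k < n -> ord k < n.
Proof. by move=> kn; apply: (prim_lt inv); apply: map_f; rewrite mem_iota. Qed.

Lemma mem_inserted v : v < n -> v \in inserted ord n.
Proof.
move=> vn; have sub : {subset inserted ord n <= iota 0 n}.
  by move=> u /(prim_lt inv); rewrite mem_iota.
have [|_ ->] := uniq_min_size (prim_uniq inv) sub; first by rewrite size_mkseq size_iota.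
by rewrite mem_iota.
Qed.

Lemma uniq_order : uniq orderV.
Proof.
rewrite map_inj_in_uniq ?(prim_uniq inv) // => i j /(prim_lt inv) lin /(prim_lt inv) ljn.
by move/eqP; rewrite vx_eq // => /eqP.
Qed.

Lemma mem_order v : v \in orderV.
Proof. by rewrite -(rankK v0 v); apply: map_f; apply: mem_inserted; apply: rank_lt. Qed.

Lemma head_order : ohead orderV = Some (vx 0).
Proof. by rewrite /orderV /inserted /mkseq; case: n n0 => //= k _; rewrite (prim_root inv). Qed.

Lemma take_order k : k <= n -> take k orderV = map vx (inserted ord k).
Proof.
by move=> kn; rewrite /orderV /inserted /mkseq -!map_take take_iota (minn_idPl kn).
Qed.

Lemma order_split P v Q : orderV = P ++ v :: Q ->
  [/\ size P < n, P = map vx (inserted ord (size P)) & v = vx (ord (size P))].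
Proof.
move=> oE; have sP : size P < n.
  have := congr1 size oE; rewrite size_map size_mkseq size_cat /=; lia.
split=> //; first by rewrite -take_order ?(ltnW sP) // oE take_size_cat.
have := congr1 (fun l => nth v0 l (size P)) oE.
by rewrite nth_cat ltnn subnn /= => <-; rewrite (nth_map 0) ?size_mkseq // nth_mkseq.
Qed.

Lemma order_cat k : k < n ->
  orderV = map vx (inserted ord k) ++ vx (ord k) :: drop k.+1 orderV.
Proof.
move=> kn; rewrite -take_order ?(ltnW kn) // -[LHS](cat_take_drop k) (drop_nth v0).
  by rewrite (nth_map 0) ?size_mkseq // nth_mkseq.
by rewrite size_map size_mkseq.
Qed.

Lemma parV_before P v Q : orderV = P ++ v :: Q -> P != [::] -> parV v \in P.
Proof.
move=> /order_split[sP PE ->] Pn0; rewrite {2}PE /parV vxK ?ord_lt //; apply: map_f.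
have j0 : 0 < size P < n by rewrite sP; case: (P) Pn0.
by have [] := prim_tree inv j0.
Qed.

Lemma root_notin_keptV : vx 0 \notin keptV.
Proof. by rewrite inE vxK // eqxx andbF. Qed.

Lemma keptVE : keptV =i map vx ks.
Proof.
move=> v; rewrite inE (keep_mem kinv) ?rank_lt // negbK inE.
apply/andP/mapP => [[+ /negPf v_0]|[i iks ->]].
  by rewrite v_0 => /= vks; exists (rank v); rewrite ?rankK.
have /andP[i0 lin] := keep_lt kinv iks.
by rewrite vxK // iks orbT -lt0n.
Qed.

Lemma card_keptV : size ks = n - agents I -> #|keptV| + agents I = n.
Proof.
move=> size_ks; rewrite (eq_card keptVE); have /card_uniqP -> : uniq (map vx ks); last first.
  by rewrite size_map size_ks subnK.
rewrite map_inj_in_uniq ?(keep_uniq kinv) // => i j.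
move=> /(keep_lt kinv)/andP[_ lin] /(keep_lt kinv)/andP[_ ljn].
by move/eqP; rewrite vx_eq // => /eqP.
Qed.

Lemma keptV_min_forest : size ks = n - agents I ->
  min_spanning_forest I (kept_forest parV keptV).
Proof.
move=> /card_keptV cardK.
apply: (kept_min_forest uniq_order mem_order head_order parV_before root_notin_keptV _ _ cardK).
- move=> P v Q /order_split[sP PE ->] Pn0 u w uP wP.
  have j0 : 0 < size P < n by rewrite sP; case: (P) Pn0.
  have [_ min_j] := prim_tree inv j0.
  move: uP; rewrite {1}PE => /mapP[u' u'P ->]; rewrite /te /parV vxK ?ord_lt //.
  rewrite -(rankK v0 w); apply: min_j => //; first exact: rank_lt.
  by apply: contra wP => wP; rewrite PE -(rankK v0 w); apply: map_f.
move=> v w vK wK wr; rewrite /te /parV -{1}(rankK v0 v) -{1}(rankK v0 w).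
apply: (keep_min kinv).
- by move: vK; rewrite keptVE => /mapP[i iks ->]; rewrite vxK //; case/andP: (keep_lt kinv iks).
- exact: rank_lt.
apply/eqP; apply: contraNT wK => wk; rewrite inE wk /=.
by apply: contraNneq wr => w_0; rewrite -w_0 rankK.
Qed.

Definition nextV (next : nat -> nat) (v : V) : V := vx (next (rank v)).

Lemma wp_link Q s : mem s 4 = par -> mem s 5 = ord -> mem s 6 = keep -> untouched 7 s ->
    (forall s', out s' = out s -> (forall i, mem s' 7 i < n) ->
      tours orderV parV keptV orderV (nextV (mem s' 7)) -> Q s') ->
  wp I link Q s.
Proof.
move=> s4 s5 s6 s7 HQ.
pose J k s' := [/\ out s' = out s, [/\ mem s' 4 = par, mem s' 5 = ord & mem s' 6 = keep],
  forall i, mem s' 7 i < n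
  & tours orderV parV keptV (map vx (inserted ord k)) (nextV (mem s' 7))].
apply: (@wp_For _ _ _ 0 _ _ 1 n _ J) => //.
- by rewrite n0 leqnn.
- split=> //= [i|]; first by rewrite s7.
  (* By zeroed memory the root points to itself, which is [tours_root] for the empty prefix. *)
  rewrite (prim_root inv) -[[:: _]]/(rcons [::] (vx 0)).
  apply: (@tours_root _ _ _ _ _ uniq_order head_order parV_before root_notin_keptV
    [::] (vx 0) (behead orderV) (nextV (mem s 7))) => //.
  + by have := head_order; case: (orderV) => //= x l [->].
  + exact: root_notin_keptV.
  + by rewrite /nextV s7.
- move=> k s1 /andP[k0 kn] s1k [o1 [p1 q1 t1] lt1 tours1].
  set v := vx (ord k); have okn := ord_lt kn.
  have oE := order_cat kn; rewrite -/v in oE.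
  have prefS : map vx (inserted ord k.+1) = rcons (map vx (inserted ord k)) v.
    by rewrite insertedS map_rcons.
  have vr : v != vx 0.
    rewrite -(root_first uniq_order head_order oE).
    by rewrite -size_eq0 size_map size_mkseq -lt0n.
  have ordk0 : ord k != 0 by apply: contraNneq vr => ok0; rewrite /v ok0.
  have vK : (v \in keptV) = (keep (ord k) != 0) by rewrite inE vxK // ordk0 andbT.
  have rank_eq u j : j < n -> (rank u == j) = (u == vx j).
    by move=> jn; rewrite -{2}(rankK v0 u) vx_eq // rank_lt.
  apply: wp_If => //=; rewrite s1k q1 t1 => kk.
    apply: wp_Seq; apply: wp_Write => //=.
      by rewrite (leq_trans (ltnW (lt1 _))) ?card_word.
    apply: wp_Write => //=.
      by rewrite q1 s1k (leq_trans (ltnW okn)) ?card_word.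
    rewrite s1k q1 p1; split=> //; split=> //=; first by move=> i; do 2!case: ifP => // _.
    have parn : par (ord k) < n := prim_par_lt inv _.
    (* Vertex and parent differ, so the two writes to array 7 hit different cells. *)
    have vpar : vx (par (ord k)) != v.
      have parP := parV_before oE; rewrite -size_eq0 size_map size_mkseq -lt0n in parP.
      move: (parP k0); rewrite /parV vxK // => parP'.
      apply: contraTneq parP' => ->; exact: (fresh uniq_order oE).
    have opar : (ord k == par (ord k)) = false.
      by apply: contraNF vpar => /eqP E; rewrite -E.
    rewrite -[vx (ord 0) :: _]/(map vx (inserted ord k.+1)) prefS.
    apply: (tours_insert uniq_order mem_order head_order parV_before root_notin_keptV
      oE _ _ _ _ tours1).
    + by rewrite vK.
    + by rewrite /nextV /parV !vxK // eqxx.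
    + by rewrite /nextV /parV !vxK // opar eqxx.
    + move=> u uv upar; rewrite /nextV !rank_eq // (negPf uv).
      by move: upar; rewrite /parV vxK // => /negPf->.
  apply: wp_Write => //=; first by rewrite q1 s1k (leq_trans (ltnW okn)) ?card_word.
  rewrite s1k q1; split=> //; split=> //=; first by move=> i; case: ifP.
  rewrite -[vx (ord 0) :: _]/(map vx (inserted ord k.+1)) prefS.
  apply: (tours_root uniq_order head_order parV_before root_notin_keptV oE _ _ _ tours1).
  + by rewrite vK kk.
  + by rewrite /nextV vxK // eqxx.
  + by move=> u uv; rewrite /nextV rank_eq // (negPf uv).
move=> s1 _ [o1 _ lt1 tours1]; exact: HQ.
Qed.

End Final.
End Program2.

(** * The compact output *)

Section Print.
Variables (R : realFieldType) (V : finType) (I : instance R V) (v0 : V).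
Variable next : nat -> nat.
Implicit Types (s : state).

Local Notation n := #|V|.
Local Notation mem := Defs.mem.
Local Notation vx := (vx v0).

Hypothesis next_lt : forall i, next i < n.

Definition output_graph : mgraph V :=
  [ffun e => \sum_v (uv v (nextV v0 next v) == e) +
             \sum_(v | e == loop v) (req I v - 1)].

Local Notation mult i j := (output_graph (uv (vx i) (vx j))).

Lemma mult_loop i : i < n -> mult i i = (next i == i) + (req I (vx i) - 1).
Proof.
move=> lin; rewrite ffunE; congr (_ + _).
  rewrite (bigD1 (vx i)) //= loopP eqxx /nextV vxK // vx_eq // big1 ?addn0 // => v /negPf vi.
  by rewrite loopP vi.
rewrite (bigD1 (vx i)) ?eqxx //= big1 ?addn0 // => v /andP[].
by rewrite loopP => /andP[/eqP-> _]; rewrite eqxx.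
Qed.

Lemma mult_edge i j : i < j < n -> mult i j = (next i == j) + (next j == i).
Proof.
move=> /andP[ij jn]; have lin := ltn_trans ij jn.
have ji : (vx j == vx i) = false by rewrite vx_eq // gtn_eqF.
rewrite ffunE [X in _ + X]big1 ?addn0 => [|v]; last first.
  by rewrite loopP => /andP[/eqP<-]; rewrite ji.
rewrite (bigD1 (vx i)) // (bigD1 (vx j)) ?ji //= big1 ?addn0 => [|v /andP[/negPf vi /negPf vj]].
  rewrite !uv_eq !eqxx ji [vx i == vx j]eq_sym ji /nextV !vxK // !vx_eq //=.
  by rewrite orbF.
by rewrite uv_eq vi vj.
Qed.

(** [p] describes the progress of the output. The normal form i <= j makes distinct pairs name
    distinct edges. *)
Definition listed (p : nat -> nat -> bool) (l : seq (nat * nat * nat)) : Prop :=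
  exists ps : seq (nat * nat),
    [/\ l = [seq (q.1, q.2, mult q.1 q.2) | q <- ps], uniq ps
      & forall i j, ((i, j) \in ps) = [&& i <= j, j < n & p i j]].

Lemma listed_eq p p' l : (forall i j, i <= j < n -> p i j = p' i j) ->
  listed p l -> listed p' l.
Proof.
move=> pp' [ps [lE ups mps]]; exists ps; split=> // i j; rewrite mps.
by case: (leqP i j) => //= ij; case: (ltnP j n) => //= jn; rewrite pp' ?ij.
Qed.

Lemma listed_rcons p p' l i j : listed p l -> i <= j < n -> ~~ p i j ->
    (forall i' j', i' <= j' < n -> p' i' j' = p i' j' || ((i', j') == (i, j))) ->
  listed p' (rcons l (i, j, mult i j)).
Proof.
move=> [ps [-> ups mps]] /andP[ij jn] pij p'E; exists (rcons ps (i, j)); split.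
- by rewrite map_rcons.
- by rewrite rcons_uniq ups mps ij jn pij.
move=> i' j'; rewrite mem_rcons inE mps orbC.
case: (leqP i' j') => ij' /=; last by apply/negP=> /eqP[ii jj]; lia.
case: (ltnP j' n) => jn' /=; last by apply/negP=> /eqP[ii jj]; lia.
by rewrite p'E ?ij'.
Qed.

Lemma listed_represents (p : nat -> nat -> bool) l :
    (forall i j, i <= j < n -> p i j) -> listed p l ->
  represents l output_graph.
Proof.
move=> pT [ps [-> ups mps]].
have mpsT i j : ((i, j) \in ps) = (i <= j < n).
  by rewrite mps; case: (leqP i j) => //= ij; case: (ltnP j n) => //= jn; rewrite pT ?ij.
have edgeE q : q \in ps -> edge_at V q.1 q.2 = Some (uv (vx q.1) (vx q.2)).
  case: q => i j; rewrite mpsT => /andP[ij jn].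
  by rewrite (edge_at_lt v0) // (leq_ltn_trans ij).
split.
- rewrite -map_comp map_inj_in_uniq // => q1 q2 q1s q2s /=.
  rewrite !edgeE // => /Some_inj/eqP; move: q1 q2 q1s q2s => [i1 j1] [i2 j2]; rewrite !mpsT /=.
  move=> /andP[ij1 jn1] /andP[ij2 jn2];
  rewrite uv_eq !vx_eq ?(leq_ltn_trans ij1, leq_ltn_trans ij2) //.
  by case/orP=> /andP[/eqP e1 /eqP e2]; congr (_, _); lia.
- move=> t /mapP[q qs ->] /=; exists (uv (vx q.1) (vx q.2)) => //; exact: edgeE.
move=> e _; have [u [v ->]] := edgeP e.
wlog uv_le : u v / rank u <= rank v.
  by move=> H; case: (leqP (rank u) (rank v)) => [/H//|/ltnW/H]; rewrite uvC.
exists (rank u, rank v, mult (rank u) (rank v)).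
  by apply/mapP; exists (rank u, rank v); rewrite ?mpsT ?uv_le ?rank_lt.
by rewrite (edge_at_lt v0) ?rank_lt // !rankK.
Qed.

Lemma ltn1_leq_leq a b : (1 < (a <= b) + (b <= a)) = (a == b).
Proof. by case: (ltngtP a b). Qed.

Lemma wp_emit_tours Q s : out s = Some [::] -> mem s 7 = next ->
    (forall s' l, out s' = Some l -> represents l output_graph -> Q s') ->
  wp I emit_tours Q s.
Proof.
move=> s_out s7 HQ.
pose J p s' := mem s' 7 = next /\ exists2 l, out s' = Some l & listed p l.
pose J1 k := J (fun i _ => i < k).
(* The loop of row [k] is emitted before the inner loop starts, hence the disjunct [j == k]. *)
pose J2 k j0 s' := J (fun i j => (i < k) || (i == k) && ((j == k) || (j < j0))) s' /\
  mem s' 0 0 = k.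
apply: (@wp_For _ _ _ 0 _ _ 0 n _ J1) => //.
- exact: leqnn.
- split=> //; exists [::] => //; exists [::]; split=> // i j.
  by rewrite ltn0 !andbF.
- move=> k s1 /= kn s1k [n1 [l1 o1 L1]].
  apply: wp_Seq; apply: wp_Emit => //.
  set s2 := emit _ _; have o2 : out s2 = Some (rcons l1 (k, k, mult k k)).
    by rewrite /s2 /= o1 /= s1k n1 (vertex_at_lt v0) // ltn1_leq_leq mult_loop.
  have L2 : listed (fun i j => (i < k) || (i == k) && ((j == k) || (j < 0)))
      (rcons l1 (k, k, mult k k)).
    apply: (listed_rcons L1); rewrite ?leqnn ?kn ?ltnn // => i j _.
    by rewrite ltn0 orbF xpair_eqE.
  apply: (@wp_For _ _ _ 1 _ _ 0 n _ (J2 k)) => //.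
  + exact: leqnn.
  + by split=> //; split=> //; exists (rcons l1 (k, k, mult k k)).
  + move=> j s3 /= jn s3j [[n3 [l3 o3 L3]] s3k].
    apply: wp_If => //=; rewrite s3k s3j addn1 => jk.
      have kj : k < j by move: jk; case: (k < j).
      apply: wp_Emit => //.
      have -> : (eval I s3 (var 0), eval I s3 (var 1),
          eval I s3 (Add (Eq (Read 7 (var 0)) (var 1)) (Eq (Read 7 (var 1)) (var 0)))) =
          (k, j, mult k j).
        by rewrite /= s3k s3j n3 !ltn1_leq_leq mult_edge ?kj.
      split=> //; split=> //; split=> //.
      exists (rcons l3 (k, j, mult k j)); first by rewrite /= o3.
      apply: (listed_rcons L3); rewrite ?(ltnW kj) //=.
        by rewrite ltnn eqxx ltnn orbF gtn_eqF.
      move=> i' j' _; rewrite xpair_eqE ltnS [j' <= j]leq_eqVlt.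
      by case: (i' < k); case: (i' == k); case: (j' == k); case: (j' == j); case: (j' < j).
    have kj : j <= k by move: jk; case: (ltnP k j).
    apply: wp_Skip; split=> //; split=> //; split=> //; exists l3 => //.
    apply: listed_eq L3 => i' j' /andP[ij' _].
    case: (eqVneq i' k) => [ik|//]; congr (_ || (_ && _)).
    by case: (eqVneq j' k) => //= j'k; apply/idP/idP; lia.
  move=> s3 _ [[n3 [l3 o3 L3]] s3k]; split=> //; split=> //; exists l3 => //.
  apply: listed_eq L3 => i j /andP[_ ->]; rewrite orbT andbT ltnS [i <= k]leq_eqVlt.
  by rewrite orbC.
move=> s1 _ [_ [l1 o1 L1]]; apply: HQ o1 _; apply: listed_represents L1 => i j /andP[].
exact: leq_ltn_trans.
Qed.

End Print.

Lemma program_correct (R : realFieldType) (V : finType) (I : instance R V) :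
  wp I program (fun s => exists2 res, outputs s res & alg_run I res) init_state.
Proof.
apply: wp_If => //= mn; last first.
  apply: wp_AnswerNo; exists None => //; apply: run_no.
  by move/eqP: mn; rewrite eqb0 -ltnNge.
have {}mn : agents I <= #|V| by move: mn; rewrite eqb0 negbK.
have n0 : 0 < #|V| := leq_trans (agents_gt0 I) mn.
have [v0 _] := card_gt0P n0.
apply: wp_Seq; apply: (wp_prim (v0 := v0)) => // s1 inv o1 z6 z7.
apply: wp_Seq; apply: (wp_select (v0 := v0)) => //; first exact: prim_par_lt inv.
move=> s2 ks o2 par2 ord2 next2 kinv size_ks.
apply: wp_Seq; apply: (wp_link mn inv) => //.
  by move=> i; rewrite next2 z7.
move=> s3 o3 next_lt tours3.
apply: (wp_emit_tours (v0 := v0) next_lt) => //; first by rewrite o3 o2 o1.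
move=> s4 l o4 repr; exists (Some (output_graph I v0 (Defs.mem s3 7))).
  by rewrite /outputs o4.
have minF := keptV_min_forest mn inv kinv size_ks.
have cardK := card_keptV mn kinv size_ks.
have parB := parV_before mn inv.
have rootN := root_notin_keptV v0 (Defs.mem s2 6) mn.
exact: (tours_alg_run (uniq_order inv) (mem_order inv) (head_order mn inv) parB
  rootN mn minF cardK tours3).
Qed.

Theorem theorem4p1 :
  (forall (R : realFieldType) (V : finType) (I : instance R V)
          (res : option (mgraph V)),
     alg_run I res ->
     ((~ exists Y, feasible I Y) -> res = None) /\
     ((exists Y, feasible I Y) ->
        exists X opt,
          [/\ res = Some X, feasible I X, is_opt I opt
            & (mcost I X <= 4%:R * opt)%R]))
  /\
  (exists (P : cmd) (k : nat),
     forall (R : realFieldType) (V : finType) (I : instance R V),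
       exists (res : option (mgraph V)) (s : state) (t : nat),
         [/\ exec I P init_state s t,
             outputs s res,
             alg_run I res
           & t <= k * (#|V| + agents I + trunc_log 2 (total_req I)) ^ k]).
Proof.
split; first exact: alg_run_approx.
have [k tk] := poly_time program; exists program, k => R V I.
have [//|s [t [ex _ [res outs run] le_t]]] := @program_correct R V I.
by exists res, s, t; split=> //; apply: leq_trans le_t (tk R V I).
Qed.
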